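(* Let $(X,\varphi)$ be a mixing Wieler solenoid and let $\mathbf P\subseteq X$ be a finite nonempty $\varphi$-invariant set. As topological groupoids, \[ \bigcup_{k\in\mathbb N}G_k(\mathbf P)=G^s(\mathbf P), \] where the left hand side is given the inductive limit topology. Moreover, $C^*(G^s(\mathbf P))$ is isomorphic to the stationary inductive limit \[ \varinjlim\,(C^*(G_0(\mathbf P)),\psi), \] where $\psi$ is the composition of the inclusion $C^*(G_0(\mathbf P))\subseteq C^*(G_1(\mathbf P))$ followed by the isomorphism $C^*(G_1(\mathbf P))\cong C^*(G_0(\mathbf P))$ induced by the groupoid isomorphism $\varphi\times\varphi:G_1(\mathbf P)\to G_0(\mathbf P)$.
   Context: Setting. $(Y,d_Y)$ is an infinite compact metric space and $g:Y\to Y$ is a continuous surjection satisfying Wieler's axioms: there are constants $\beta>0$, an integer $K\ge 1$ and $0<\gamma<1$ such that (Axiom 1) if $d_Y(x,y)\le\beta$ then $d_Y(g^K(x),g^K(y))\le\gamma^K d_Y(g^{2K}(x),g^{2K}(y))$; (Axiom 2) for all $x\in Y$ and $0<\epsilon\le\beta$, $g^K(B(g^K(x),\epsilon))\subseteq g^{2K}(B(x,\gamma\epsilon))$. The Wieler solenoid is $X=\varprojlim(Y,g)=\{\mathbf x=(x_n)_{n\in\mathbb N}: x_n\in Y,\ g(x_{n+1})=x_n\}$ with $\varphi(x_0,x_1,\dots)=(g(x_0),x_0,x_1,\dots)$ and metric $d_X(\mathbf x,\mathbf y)=\sum_{i=0}^K\gamma^i d'_X(\varphi^i(\mathbf x),\varphi^i(\mathbf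 y))$, $d'_X(\mathbf x,\mathbf y)=\sup_n\gamma^n d_Y(x_n,y_n)$. By Wieler, it is a Smale space with constants $\epsilon_X=\beta/2$, $\lambda=\gamma$; for $0<\epsilon\le\beta/2$ the local stable and unstable sets are $X^s(\mathbf x,\epsilon)=\{\mathbf y: y_m=x_m\ (0\le m\le K-1),\ d_X(\mathbf x,\mathbf y)<\epsilon\}$ and $X^u(\mathbf x,\epsilon)=\{\mathbf y: d_Y(x_n,y_n)<\epsilon\ \forall n,\ d_X(\mathbf x,\mathbf y)<\epsilon\}$; the bracket $[\mathbf x,\mathbf y]$ is the point such that $X^s(\mathbf x,\epsilon)\cap X^u(\mathbf y,\epsilon)=\{[\mathbf x,\mathbf y]\}$ whenever this intersection is nonempty. Mixing means: for all nonempty open $U,V\subseteq X$ there is $N$ with $\varphi^n(U)\cap V\ne\emptyset$ for all $n\ge N$. Groupoid $G^s(\mathbf P)$. Write $\mathbf x\sim_s\mathbf y$ if $d_X(\varphi^n(\mathbf x),\varphi^n(\mathbf y))\to0$ and $\mathbf x\sim_u\mathbf y$ if $d_X(\varphi^{-n}(\mathbf x),\varphi^{-n}(\mathbf y))\to0$ as $n\to\infty$. $\mathbf P$ is a finite nonempty $\varphi$-invariant set of periodic points; $X^u(\mathbf P)=\{\mathbf x:\mathbf x\sim_u\mathbf p\text{ for some }\mathbf p\in\mathbf P\}$, with the locally compact Hausdorff topology having the sets $X^u(\mathbf x,\delta)$ (small $\delta>0$) as neighborhood base (not the topology inherited from $X$). $G^s(\mathbf P)=\{(\mathbf x,\mathbf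 y)\in X^u(\mathbf P)\times X^u(\mathbf P):\mathbf x\sim_s\mathbf y\}$ has the étale topology with neighborhood base the sets $\{(h(\mathbf z),\mathbf z):\mathbf z\in X^u(\mathbf y,\delta)\}$, where $(\mathbf x,\mathbf y)\in G^s(\mathbf P)$, $k$ satisfies $\varphi^k(\mathbf x)\in X^s(\varphi^k(\mathbf y),\epsilon_X/2)$, $\delta>0$ satisfies $\varphi^k(X^u(\mathbf y,\delta))\subseteq X^u(\varphi^k(\mathbf y),\epsilon_X/2)$, and $h(\mathbf z)=\varphi^{-k}([\varphi^k(\mathbf z),\varphi^k(\mathbf x)])$. With this topology $G^s(\mathbf P)$ is amenable, second countable, locally compact and Hausdorff; $C^*(G^s(\mathbf P))$ is its groupoid $C^*$-algebra. Relation $\sim_0$. Fix $K_0\in\mathbb N$ with $K_0\ge K$ such that $x_i=y_i$ for all $i\le K_0$ implies $d_X(\mathbf x,\mathbf y)<\beta/4$; fix $0<\epsilon_Y<\beta/4$ with $\varphi^{K_0}(X^u(\mathbf x,\epsilon_Y))\subseteq X^u(\varphi^{K_0}(\mathbf x),\beta/4)$ for all $\mathbf x\in X$. Let $\pi_0:X^u(\mathbf P)\to Y$, $\pi_0(\mathbf x)=x_0$. For $\mathbf x,\mathbf y\in X^u(\mathbf P)$, $\mathbf x\sim_0\mathbf y$ means: (1) $\pi_0(\mathbf x)=\pi_0(\mathbf y)$; (2) there exist $0<\delta_{\mathbf x}<\epsilon_Y$ and an open set $U\subseteq X^u(\mathbf y,\epsilon_Y)$ with $\pi_0(X^u(\mathbf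 x,\delta_{\mathbf x}))=\pi_0(U)$. This is an equivalence relation, and $G_0(\mathbf P)=\{(\mathbf x,\mathbf y):\mathbf x\sim_0\mathbf y\}$ is an open (hence étale) subgroupoid of $G^s(\mathbf P)$. For $k\in\mathbb N$, $G_k(\mathbf P)=\{(\mathbf x,\mathbf y)\in X^u(\mathbf P)\times X^u(\mathbf P):\varphi^k(\mathbf x)\sim_0\varphi^k(\mathbf y)\}$; these are open subgroupoids of $G^s(\mathbf P)$ with $G_k(\mathbf P)\subseteq G_{k+1}(\mathbf P)$, and $\varphi^k\times\varphi^k:G_k(\mathbf P)\to G_0(\mathbf P)$ is an isomorphism of topological groupoids. The inclusion $C^*(G_0(\mathbf P))\subseteq C^*(G_1(\mathbf P))$ is extension of functions by zero; explicitly $\psi(f)(\mathbf x,\mathbf y)=f(\varphi^{-1}(\mathbf x),\varphi^{-1}(\mathbf y))$, interpreted as $0$ if $\varphi^{-1}(\mathbf x)\not\sim_0\varphi^{-1}(\mathbf y)$. *)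

(* Defs.v *)
From HB Require Import structures.
From mathcomp Require Import all_boot all_order all_algebra.
From mathcomp Require Import all_classical all_reals.
From mathcomp Require Import topology normedtype sequences ereal.
From mathcomp Require Import complex.

Set Implicit Arguments.
Unset Strict Implicit.
Unset Printing Implicit Defensive.

Import Order.TTheory GRing.Theory Num.Theory numFieldNormedType.Exports.

Local Open Scope classical_set_scope.
Local Open Scope ring_scope.

(* The complex numbers, seen as an abstract numeric field so that they carry
   their norm topology. *)
Definition Cx (R : realType) : numClosedFieldType := R[i]%C.

Record cstarAlg (R : realType) := CstarAlg {
  cs_sort :> completeNormedModType (Cx R) ;
  cs_mul : cs_sort -> cs_sort -> cs_sort ;
  cs_star : cs_sort -> cs_sort ;
  cs_mulA : forall x y z, cs_mul x (cs_mul y z) = cs_mul (cs_mul x y) z ;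
  cs_mul_linl : forall (a : Cx R) x y z,
    cs_mul (a *: x + y) z = a *: cs_mul x z + cs_mul y z ;
  cs_mul_linr : forall (a : Cx R) x y z,
    cs_mul z (a *: x + y) = a *: cs_mul z x + cs_mul z y ;
  cs_starK : forall x, cs_star (cs_star x) = x ;
  cs_star_antilin : forall (a : Cx R) x y,
    cs_star (a *: x + y) = a^* *: cs_star x + cs_star y ;
  cs_starM : forall x y, cs_star (cs_mul x y) = cs_mul (cs_star y) (cs_star x) ;
  cs_normM : forall x y, `|cs_mul x y| <= `|x| * `|y| ;
  cs_normC : forall x, `|cs_mul (cs_star x) x| = `|x| ^+ 2 }.

(* The norm of a normed module over [Cx R] takes its values in [Cx R]. *)
Definition cs_norm (R : realType) (A : cstarAlg R) (a : A) : R :=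
  complex.Re (`|a| : R[i]%C).

Definition is_star_hom (R : realType) (A B : cstarAlg R) (f : A -> B) : Prop :=
  [/\ (forall (a : Cx R) (x y : A), f (a *: x + y) = a *: f x + f y),
      (forall x y : A, f (cs_mul x y) = cs_mul (f x) (f y)) &
      (forall x : A, f (cs_star x) = cs_star (f x))].

Definition is_star_iso (R : realType) (A B : cstarAlg R) (f : A -> B) : Prop :=
  is_star_hom f /\ bijective f.

Definition cstar_isomorphic (R : realType) (A B : cstarAlg R) : Prop :=
  exists f : A -> B, is_star_iso f.

Definition is_stationary_cocone (R : realType) (B : cstarAlg R) (psi : B -> B)
    (D : cstarAlg R) (nu : nat -> B -> D) : Prop :=
  (forall n, is_star_hom (nu n)) /\ (forall n b, nu n.+1 (psi b) = nu n b).

(* [(L, mu)] is the inductive limit, in the category of C*-algebras and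
   *-homomorphisms, of the sequence B -psi-> B -psi-> B -psi-> ... *)
Definition is_stationary_limit (R : realType) (B : cstarAlg R) (psi : B -> B)
    (L : cstarAlg R) (mu : nat -> B -> L) : Prop :=
  is_stationary_cocone psi mu /\
  forall (D : cstarAlg R) (nu : nat -> B -> D), is_stationary_cocone psi nu ->
    exists! theta : L -> D,
      is_star_hom theta /\ (forall n b, theta (mu n b) = nu n b).

(* U is open in the union of the A k, each with the subspace topology, for the
   inductive limit topology. *)
Definition inductive_limit_open (T : topologicalType) (A : nat -> set T)
    (U : set T) : Prop :=
  forall k, @open (subspace (A k)) U.

Record wielerData (R : realType) := WielerData {
  wY : metricType R ;
  wg : wY -> wY ;
  wbeta : R ;
  wK : nat ;
  wgamma : R ;
  wY_infinite : infinite_set [set: wY] ;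
  wY_compact : compact [set: wY] ;
  wg_continuous : continuous wg ;
  wg_surjective : forall y, exists x, wg x = y ;
  wbeta_gt0 : 0 < wbeta ;
  wK_ge1 : (1 <= wK)%N ;
  wgamma_gt0 : 0 < wgamma ;
  wgamma_lt1 : wgamma < 1 ;
  wieler_axiom1 : forall x y : wY, mdist x y <= wbeta ->
    mdist (iter wK wg x) (iter wK wg y) <=
    wgamma ^+ wK * mdist (iter (2 * wK)%N wg x) (iter (2 * wK)%N wg y) ;
  wieler_axiom2 : forall (x : wY) (e : R), 0 < e -> e <= wbeta ->
    iter wK wg @` ball (iter wK wg x) e `<=`
    iter (2 * wK)%N wg @` ball x (wgamma * e) }.

Section Solenoid.
Context (R : realType) (W : wielerData R).

Local Notation Y := (wY W).
Local Notation g := (@wg R W).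
Local Notation K := (wK W).
Local Notation gamma := (wgamma W).

Record solenoid := Solenoid {
  sol_coord : nat -> Y ;
  solenoidP : forall n, g (sol_coord n.+1) = sol_coord n }.

HB.instance Definition _ := gen_eqMixin solenoid.
HB.instance Definition _ := gen_choiceMixin solenoid.

Lemma solenoid_eq (x y : solenoid) : sol_coord x =1 sol_coord y -> x = y.
Proof.
case: x y => [x xP] [y yP] /= /funext xy; subst y.
by congr Solenoid; exact: Prop_irrelevance.
Qed.

Definition phi_coord (x : solenoid) (n : nat) : Y :=
  if n is m.+1 then sol_coord x m else g (sol_coord x 0).

Lemma phi_solP (x : solenoid) n : g (phi_coord x n.+1) = phi_coord x n.
Proof. by case: n => [//|n]; exact: solenoidP. Qed.

Definition phi (x : solenoid) : solenoid := Solenoid (phi_solP x).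

Definition phi_inv (x : solenoid) : solenoid :=
  @Solenoid (fun n => sol_coord x n.+1) (fun n => solenoidP x n.+1).

Lemma phiK : cancel phi phi_inv.
Proof. by move=> x; apply: solenoid_eq. Qed.

Lemma phi_invK : cancel phi_inv phi.
Proof. by move=> x; apply: solenoid_eq => -[|n] //=; exact: solenoidP. Qed.

Definition dX' (x y : solenoid) : R :=
  sup [set gamma ^+ n * mdist (sol_coord x n) (sol_coord y n) | n in [set: nat]].

Definition dX (x y : solenoid) : R :=
  \sum_(0 <= i < K.+1) gamma ^+ i * dX' (iter i phi x) (iter i phi y).

Lemma dXC (x y : solenoid) : dX x y = dX y x.
Proof.
apply: eq_bigr => i _; congr (_ * sup _); apply: eq_imagel => n _.
by rewrite metric_sym.
Qed.

Definition openX (U : set solenoid) : Prop :=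
  forall x, U x -> exists2 e : R, 0 < e & [set y | dX x y < e] `<=` U.

Definition mixing : Prop :=
  forall U V : set solenoid, openX U -> openX V -> U !=set0 -> V !=set0 ->
    exists N : nat, forall n : nat, (N <= n)%N ->
      (iter n phi @` U) `&` V !=set0.

Definition epsX : R := wbeta W / 2.

(* [Xs] and [Xu] are only meaningful for radii in ]0, epsX]. *)
Definition Xs (x : solenoid) (e : R) : set solenoid :=
  [set y | (forall m, (m < K)%N -> sol_coord y m = sol_coord x m) /\ dX x y < e].

Definition Xu (x : solenoid) (e : R) : set solenoid :=
  [set y | (forall n, mdist (sol_coord x n) (sol_coord y n) < e) /\ dX x y < e].

(* [is_bracket x y w] : the bracket [x, y] is defined and equal to w. *)
Definition is_bracket (x y w : solenoid) : Prop :=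
  exists e : R, [/\ 0 < e, e <= epsX & Xs x e `&` Xu y e = [set w]].

Definition sim_s (x y : solenoid) : Prop :=
  dX (iter n phi x) (iter n phi y) @[n --> \oo] --> (0 : R).

Definition sim_u (x y : solenoid) : Prop :=
  dX (iter n phi_inv x) (iter n phi_inv y) @[n --> \oo] --> (0 : R).

(* The points of a finite invariant set are periodic, as phi is injective. *)
Record invariantSet := InvariantSet {
  inv_set :> set solenoid ;
  inv_finite : finite_set inv_set ;
  inv_nonempty : inv_set !=set0 ;
  inv_phi : phi @` inv_set = inv_set }.

Section Groupoids.
Variable P : invariantSet.

Definition XuP : set solenoid := [set x | exists2 p, inv_set P p & sim_u x p].

(* The topology of [XuP] in which the sets [Xu x d] form a neighborhood base. *)
Definition openXuP (U : set solenoid) : Prop :=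
  U `<=` XuP /\
  forall x, U x -> exists d : R, [/\ 0 < d, d <= epsX & Xu x d `<=` U].

Definition Gs : set (solenoid * solenoid) :=
  [set xy | [/\ XuP xy.1, XuP xy.2 & sim_s xy.1 xy.2]].

Record GsT := GsElt {
  gs_val : solenoid * solenoid ;
  gs_valP : Gs gs_val }.

HB.instance Definition _ := gen_eqMixin GsT.
HB.instance Definition _ := gen_choiceMixin GsT.

(* The last condition says that h z = phi^-k [phi^k z, phi^k x] is defined for
   every z in [Xu y d]. *)
Definition gs_admissible (p : solenoid * solenoid) (k : nat) (d : R) : Prop :=
  let: (x, y) := p in
  [/\ Xs (iter k phi y) (epsX / 2) (iter k phi x),
      0 < d, d <= epsX,
      iter k phi @` Xu y d `<=` Xu (iter k phi y) (epsX / 2) &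
      forall z, Xu y d z -> exists w, is_bracket (iter k phi z) (iter k phi x) w].

(* The set of the (h z, z) for z in [Xu y d]; since phi is bijective,
   w = h z means that phi^k w is the bracket [phi^k z, phi^k x]. *)
Definition gs_basic (p : solenoid * solenoid) (k : nat) (d : R) : set GsT :=
  [set q | Xu p.2 d (gs_val q).2 /\
    is_bracket (iter k phi (gs_val q).2) (iter k phi p.1)
               (iter k phi (gs_val q).1)].

(* The neighborhood filter of p for which the sets [gs_basic] form a base;
   generating it as a filter avoids proving here that they are directed. *)
Definition gs_nbhs (p : GsT) : set_system GsT :=
  smallest Filter [set B | exists k d,
    gs_admissible (gs_val p) k d /\ B = gs_basic (gs_val p) k d].

#[global] Instance gs_nbhs_filter (p : GsT) : Filter (gs_nbhs p).
Proof. exact: smallest_filter_filter. Qed.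

Definition gs_open (U : set GsT) : Prop := forall p, U p -> gs_nbhs p U.

Lemma gs_openT : gs_open setT.
Proof. by move=> p _; exact: filterT. Qed.

Lemma gs_openI : setI_closed gs_open.
Proof.
by move=> U V oU oV p [Up Vp]; exact: (@filterI _ (gs_nbhs p)) (oU p Up) (oV p Vp).
Qed.

Lemma gs_open_bigU (I : Type) (f : I -> set GsT) :
  (forall i, gs_open (f i)) -> gs_open (\bigcup_i f i).
Proof.
move=> of_ p [i _ fip].
by apply: (@filterS _ (gs_nbhs p)) (of_ i p fip) => q fiq; exists i.
Qed.

HB.instance Definition _ :=
  isOpenTopological.Build GsT gs_openT gs_openI gs_open_bigU.

Definition pi0 (x : solenoid) : Y := sol_coord x 0.

Definition sim0 (epsY : R) (x y : solenoid) : Prop :=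
  [/\ XuP x, XuP y, pi0 x = pi0 y &
      exists (d : R) (U : set solenoid),
        [/\ 0 < d < epsY, openXuP U, U `<=` Xu y epsY &
            pi0 @` Xu x d = pi0 @` U]].

Definition Gk (epsY : R) (k : nat) : set (solenoid * solenoid) :=
  [set xy | [/\ XuP xy.1, XuP xy.2 &
    sim0 epsY (iter k phi xy.1) (iter k phi xy.2)]].

Definition GkT (epsY : R) (k : nat) : set GsT :=
  [set p | Gk epsY k (gs_val p)].

Lemma gs_inv_subproof (p : GsT) : Gs ((gs_val p).2, (gs_val p).1).
Proof.
have [xP yP xy] := gs_valP p; split => //=.
by rewrite /sim_s; under eq_fun do rewrite dXC.
Qed.

Definition gs_inv (p : GsT) : GsT := GsElt (gs_inv_subproof p).

Definition gs_is_mul (a b p : GsT) : Prop :=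
  [/\ (gs_val a).2 = (gs_val b).1,
      (gs_val a).1 = (gs_val p).1 &
      (gs_val b).2 = (gs_val p).2].

Lemma iter_phi_phi_inv n x : phi (iter n phi (phi_inv x)) = iter n phi x.
Proof. by rewrite -iterS iterSr phi_invK. Qed.

Lemma XuP_phi_inv x : XuP x -> XuP (phi_inv x).
Proof.
move=> [p Pp xp]; have : (phi @` P) p by rewrite inv_phi.
move=> [q Pq qp]; exists q => //; rewrite /sim_u.
have -> : q = phi_inv p by rewrite -qp phiK.
under eq_fun do rewrite -!iterSr.
by move: xp; rewrite /sim_u -(cvg_shiftS (fun n => dX (iter n _ x) _)).
Qed.

Lemma gs_phi_inv_subproof (p : GsT) :
  Gs (phi_inv (gs_val p).1, phi_inv (gs_val p).2).
Proof.
have [xP yP xy] := gs_valP p.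
split; [exact: XuP_phi_inv | exact: XuP_phi_inv|].
rewrite /sim_s -(cvg_shiftS (fun n => dX (iter n _ _) _)) /=.
by under eq_fun do rewrite !iter_phi_phi_inv.
Qed.

(* The inverse of phi x phi. *)
Definition gs_phi_inv (p : GsT) : GsT := GsElt (gs_phi_inv_subproof p).

(* For a subgroupoid A of G^s(P) with the subspace topology, an element of
   C_c(A) is represented by its extension by zero to G^s(P). *)
Definition Cc (A : set GsT) : set (GsT -> Cx R) :=
  [set f | [/\ (forall p, ~ A p -> f p = 0),
               {within A, continuous f} &
               exists2 C : set GsT, compact C /\ C `<=` A &
                 forall p, ~ C p -> f p = 0]].

Definition convol (f h : GsT -> Cx R) (p : GsT) : Cx R :=
  \sum_(ab \in [set ab : GsT * GsT | gs_is_mul ab.1 ab.2 p]) (f ab.1 * h ab.2).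

Definition invol (f : GsT -> Cx R) (p : GsT) : Cx R := (f (gs_inv p))^*.

Definition is_Cc_star_hom (A : set GsT) (D : cstarAlg R)
    (rho : (GsT -> Cx R) -> D) : Prop :=
  [/\ (forall (a : Cx R) f h, Cc A f -> Cc A h ->
         rho (fun p => a * f p + h p) = a *: rho f + rho h),
      (forall f h, Cc A f -> Cc A h ->
         rho (convol f h) = cs_mul (rho f) (rho h)) &
      (forall f, Cc A f -> rho (invol f) = cs_star (rho f))].

(* The full norm on C_c(A); by the Gelfand-Naimark theorem, *-homomorphisms
   into C*-algebras and *-representations on Hilbert spaces give the same
   supremum. *)
Definition full_norm (A : set GsT) (f : GsT -> Cx R) : \bar R :=
  ereal_sup [set r | exists (D : cstarAlg R) (rho : (GsT -> Cx R) -> D),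
    is_Cc_star_hom A rho /\ r = (cs_norm (rho f))%:E].

(* [(B, iota)] is C*(A), the completion of C_c(A) in the full norm, iota being
   the canonical map from C_c(A). *)
Definition is_groupoid_cstar (A : set GsT) (B : cstarAlg R)
    (iota : (GsT -> Cx R) -> B) : Prop :=
  [/\ is_Cc_star_hom A iota,
      dense (iota @` Cc A) &
      forall f, Cc A f -> (cs_norm (iota f))%:E = full_norm A f].

(* The *-homomorphism C*(A0) -> C*(A1) given on C_c(A0) by extension by zero,
   for A0 an open subgroupoid of A1. *)
Definition is_cstar_inclusion (A0 : set GsT) (B0 B1 : cstarAlg R)
    (iota0 : (GsT -> Cx R) -> B0) (iota1 : (GsT -> Cx R) -> B1)
    (j : B0 -> B1) : Prop :=
  is_star_hom j /\ forall f, Cc A0 f -> j (iota0 f) = iota1 f.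

(* The *-isomorphism C*(A1) -> C*(A0) induced by the isomorphism
   phi x phi : A1 -> A0. *)
Definition is_cstar_phi_iso (A1 : set GsT) (B1 B0 : cstarAlg R)
    (iota1 : (GsT -> Cx R) -> B1) (iota0 : (GsT -> Cx R) -> B0)
    (alpha : B1 -> B0) : Prop :=
  is_star_iso alpha /\
  forall f, Cc A1 f -> alpha (iota1 f) = iota0 (f \o gs_phi_inv).

End Groupoids.
End Solenoid.

Arguments GkT {R W} P epsY k _ : rename.
Arguments Gk {R W} P epsY k _ : rename.

(* Main.v *)
Require Import Defs.
From mathcomp Require Import all_boot all_order all_algebra.
From mathcomp Require Import all_classical all_reals.
From mathcomp Require Import topology normedtype sequences ereal.
From mathcomp Require Import complex zify ring lra.
Set Implicit Arguments.
Unset Strict Implicit.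
Unset Printing Implicit Defensive.
Import Order.TTheory GRing.Theory Num.Theory numFieldNormedType.Exports.
Local Open Scope classical_set_scope.
Local Open Scope ring_scope.

(** Axiom 1 contracts only after K iterates, so it is read along the coordinates of a solenoid
    point, where x_n = g^(2K) x_(n+2K). Axiom 2 loses K iterates: it lifts g^K v, not v, which is
    why equal K-th coordinates are needed to get equal germs.

    The groupoid topology is handled without brackets. If phi^m x and phi^m y have the same germ,
    then near (x, y) the local homeomorphism h is determined by the equation g^m (h z)_0 = g^m z_0.
    Any larger m describes the same neighborhoods, so two elements can be moved to a common level
    before they are multiplied.

    Continuity of *-homomorphisms is usually read off from the spectral radius formula. Here
    inverses in the unitization are encoded by quasi-inverses, which homomorphisms preserve, and the
    formula is replaced by playing |b^(2^k)| = |b|^(2^k), for self-adjoint b, against the Lipschitz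
    bound of the resolvent on a disc. *)

(** Idea. Axiom 1 makes the zeroth coordinate injective, with uniformly
    continuous inverse, on every small unstable set, and forces stably
    equivalent points to have equal coordinates after finitely many iterations
    of [phi]; axiom 2 lifts a point near the K-th coordinate of y to a point
    unstably near y. So x ~_0 y says that x_0 = y_0 and that the images in Y of
    small unstable neighborhoods of x and of y have the same germ at this
    point. This condition is open, is preserved by [phi], and holds for
    (phi^k x, phi^k y) with k large as soon as x ~_s y. Hence the G_k form an
    increasing open cover of G^s, which gives the equality of topologies.

    For the C*-algebras, a compactly supported function on G^s lives on some
    G_k and corresponds under phi^k to one on G_0. C*(G^s) is therefore itself
    the limit, its n-th structure map extending f |-> f o (phi x phi)^n. Maps
    out of a completion are obtained by extension from the dense image of C_c,
    the full norm providing the bound; maps already given are determined by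
    their values there because *-homomorphisms are automatically continuous. *)

(** * C*-algebras without unit *)

Definition Cnorm (R : realType) (z : Cx R) : R := complex.Re (`|z| : R[i]%C).

Section ComplexNorm.
Variable R : realType.
Implicit Types z w : Cx R.

Lemma CnormE z : (Cnorm z)%:C%C = `|z|.
Proof. exact: (@RRe_real R (`|z| : R[i]%C) (normr_real z)). Qed.

Lemma Cnorm_ge0 z : 0 <= Cnorm z.
Proof. by rewrite -lecR CnormE; exact: normr_ge0. Qed.

Lemma CnormD z w : Cnorm (z + w) <= Cnorm z + Cnorm w.
Proof. by rewrite -lecR rmorphD /= !CnormE ler_normD. Qed.

Lemma CnormM z w : Cnorm (z * w) = Cnorm z * Cnorm w.
Proof. by apply: complexI; rewrite rmorphM /= !CnormE normrM. Qed.

Lemma CnormN z : Cnorm (- z) = Cnorm z.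
Proof. by rewrite /Cnorm normrN. Qed.

Lemma Cnorm_real (x : R) : Cnorm (x%:C%C : Cx R) = `|x|.
Proof. by rewrite /Cnorm normc_def /= expr0n addr0 sqrtr_sqr. Qed.

Lemma Cnorm_sqr z : Cnorm (z ^+ 2) = Cnorm z ^+ 2.
Proof. by rewrite !expr2 CnormM. Qed.

Lemma Cnorm1 : Cnorm (1 : Cx R) = 1.
Proof. by rewrite /Cnorm normr1. Qed.

Lemma Cnorm_le (x y : R) : Cnorm (Complex x y : Cx R) <= `|x| + `|y|.
Proof.
rewrite /Cnorm normc_def /= -(ler_pXn2r (n := 2)) ?nnegrE ?sqrtr_ge0 ?addr_ge0//.
rewrite sqr_sqrtr ?addr_ge0 ?sqr_ge0// sqrrD !real_normK ?num_real//.
by rewrite addrAC lerDl mulrn_wge0 // mulr_ge0.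
Qed.

Lemma Cnorm_ge_Re z : `|complex.Re z| <= Cnorm z.
Proof.
rewrite /Cnorm normc_def /= -sqrtr_sqr ler_wsqrtr // lerDl; exact: sqr_ge0.
Qed.

Lemma Cnorm_ge_Im z : `|complex.Im z| <= Cnorm z.
Proof.
rewrite /Cnorm normc_def /= -sqrtr_sqr ler_wsqrtr // lerDr; exact: sqr_ge0.
Qed.

End ComplexNorm.

Section CstarNorm.
Variables (R : realType) (A : cstarAlg R).
Implicit Types x y z : A.

Lemma cs_normE x : (cs_norm x)%:C%C = `|x| :> Cx R.
Proof. exact: (@RRe_real R (`|x| : R[i]%C) (normr_real x)). Qed.

Lemma cs_norm_ge0 x : 0 <= cs_norm x.
Proof. by rewrite -lecR cs_normE; exact: normr_ge0. Qed.

Lemma cs_normD x y : cs_norm (x + y) <= cs_norm x + cs_norm y.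
Proof. by rewrite -lecR rmorphD /= !cs_normE ler_normD. Qed.

Lemma cs_normN x : cs_norm (- x) = cs_norm x.
Proof. by rewrite /cs_norm normrN. Qed.

Lemma cs_normB x y : cs_norm (x - y) <= cs_norm x + cs_norm y.
Proof. by rewrite -(cs_normN y) cs_normD. Qed.

Lemma cs_distC x y : cs_norm (x - y) = cs_norm (y - x).
Proof. by rewrite -cs_normN opprB. Qed.

Lemma cs_dist_triangle y x z :
  cs_norm (x - z) <= cs_norm (x - y) + cs_norm (y - z).
Proof. by rewrite (le_trans _ (cs_normD _ _)) // addrA subrK. Qed.

Lemma cs_normZ (a : Cx R) x : cs_norm (a *: x) = Cnorm a * cs_norm x.
Proof. by apply: complexI; rewrite rmorphM /= cs_normE CnormE cs_normE normrZ. Qed.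

Lemma cs_norm_mul x y : cs_norm (cs_mul x y) <= cs_norm x * cs_norm y.
Proof. by rewrite -lecR rmorphM /= !cs_normE cs_normM. Qed.

Lemma cs_norm_sqr x : cs_norm (cs_mul (cs_star x) x) = cs_norm x ^+ 2.
Proof. by apply: complexI; rewrite rmorphXn /= !cs_normE cs_normC. Qed.

Lemma cs_norm0 : cs_norm (0 : A) = 0.
Proof. by rewrite /cs_norm normr0. Qed.

Lemma cs_norm0_eq0 x : cs_norm x = 0 -> x = 0.
Proof. by move=> x0; apply/normr0_eq0; rewrite -cs_normE x0. Qed.

Lemma cs_norm_small x : (forall e : R, 0 < e -> cs_norm x <= e) -> x = 0.
Proof.
move=> xe; apply: cs_norm0_eq0; apply/eqP; rewrite eq_le cs_norm_ge0 andbT.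
by apply/ler_addgt0Pl => e e0; rewrite addr0 xe.
Qed.

Lemma cs_mul0l x : cs_mul 0 x = 0.
Proof.
have := @cs_mul_linl R A 1 0 0 x; rewrite scaler0 addr0 scale1r => /eqP.
by rewrite -[X in X == _]addr0 (inj_eq (addrI _)) => /eqP.
Qed.

Lemma cs_mul0r x : cs_mul x 0 = 0.
Proof.
have := @cs_mul_linr R A 1 0 0 x; rewrite scaler0 addr0 scale1r => /eqP.
by rewrite -[X in X == _]addr0 (inj_eq (addrI _)) => /eqP.
Qed.

Lemma cs_mulDl x y z : cs_mul (x + y) z = cs_mul x z + cs_mul y z.
Proof. by have := @cs_mul_linl R A 1 x y z; rewrite !scale1r. Qed.

Lemma cs_mulDr x y z : cs_mul z (x + y) = cs_mul z x + cs_mul z y.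
Proof. by have := @cs_mul_linr R A 1 x y z; rewrite !scale1r. Qed.

Lemma cs_mulZl (a : Cx R) x y : cs_mul (a *: x) y = a *: cs_mul x y.
Proof. by have := @cs_mul_linl R A a x 0 y; rewrite !addr0 cs_mul0l addr0. Qed.

Lemma cs_mulZr (a : Cx R) x y : cs_mul y (a *: x) = a *: cs_mul y x.
Proof. by have := @cs_mul_linr R A a x 0 y; rewrite !addr0 cs_mul0r addr0. Qed.

Lemma cs_mulNl x y : cs_mul (- x) y = - cs_mul x y.
Proof. by rewrite -scaleN1r cs_mulZl scaleN1r. Qed.

Lemma cs_mulNr x y : cs_mul y (- x) = - cs_mul y x.
Proof. by rewrite -scaleN1r cs_mulZr scaleN1r. Qed.

Lemma cs_mulBl x y z : cs_mul (x - y) z = cs_mul x z - cs_mul y z.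
Proof. by rewrite cs_mulDl cs_mulNl. Qed.

Lemma cs_mulBr x y z : cs_mul z (x - y) = cs_mul z x - cs_mul z y.
Proof. by rewrite cs_mulDr cs_mulNr. Qed.

Lemma cs_star0 : cs_star (0 : A) = 0.
Proof.
have := @cs_star_antilin R A 1 0 0.
rewrite scaler0 addr0 conjC1 scale1r => /eqP.
by rewrite -[X in X == _]addr0 (inj_eq (addrI _)) => /eqP.
Qed.

Lemma cs_starD x y : cs_star (x + y) = cs_star x + cs_star y.
Proof. by have := @cs_star_antilin R A 1 x y; rewrite conjC1 !scale1r. Qed.

Lemma cs_starB x y : cs_star (x - y) = cs_star x - cs_star y.
Proof.
rewrite cs_starD; congr (_ + _); have := @cs_star_antilin R A (-1) y 0.
by rewrite !addr0 cs_star0 addr0 rmorphN1 !scaleN1r.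
Qed.

(** The C*-identity gives |y|^2 = |y* y| <= |y*| |y|, hence |y| <= |y*|; the reverse inequality is
    the same one for the adjoint. *)
Lemma cs_norm_star x : cs_norm (cs_star x) = cs_norm x.
Proof.
suff h y : cs_norm y <= cs_norm (cs_star y).
  by apply/eqP; rewrite eq_le h -{2}(cs_starK x) h.
have [->|y0] := eqVneq (cs_norm y) 0; first exact: cs_norm_ge0.
have y_gt0 : 0 < cs_norm y by rewrite lt0r y0 cs_norm_ge0.
by rewrite -(ler_pM2r y_gt0) -expr2 -cs_norm_sqr cs_norm_mul.
Qed.

Lemma cs_complete (u : nat -> A) :
  (forall e : R, 0 < e -> exists N, forall m n, (N <= m)%N -> (N <= n)%N ->
     cs_norm (u m - u n) < e) ->
  exists l, forall e : R, 0 < e -> exists N, forall n, (N <= n)%N ->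
     cs_norm (u n - l) < e.
Proof.
move=> cu.
have /cauchy_cvgP/cvg_ex[l ul] : cauchy (u @ \oo).
  (* Balls have complex radii; positivity in the order of [Cx R] forces the radius to be real, so
     real tolerances suffice. *)
  apply/cauchy_ballP => e; rewrite ltcE /= => /andP[/eqP eim e0].
  have [N Nu] := cu _ e0.
  exists (u @` [set n | (N <= n)%N], u @` [set n | (N <= n)%N]) => /=.
    by split; exists N => // n Nn; exists n.
  move=> [_ _] /= [[m Nm <-] [n Nn <-]]; rewrite -ball_normE /ball_ /= -cs_normE ltcE /=.
  by rewrite eim eqxx Nu.
exists l => e e0.
have e0' : 0 < (e%:C%C : Cx R) by rewrite ltcR.
have /cvgr_distC_lt /(_ _ e0') [N _ Nu] := ul.
by exists N => n /Nu /=; rewrite -cs_normE ltcR.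
Qed.

(* [1 + q] is the inverse of [1 - x] in the unitization. *)
Definition quasi_inverse x q := q = x + cs_mul x q /\ q = x + cs_mul q x.

(** Neumann series: the iterates [s n] are the partial sums x + ... + x^n. They commute with x
    ([sSr]), so the limit satisfies both one-sided equations. *)
Lemma quasi_inverse_exists x : cs_norm x < 1 -> exists q, quasi_inverse x q.
Proof.
move=> x1; set r := cs_norm x in x1; have r0 : 0 <= r := cs_norm_ge0 x.
pose s n := iter n (fun y => x + cs_mul x y) (0 : A).
have sS n : s n.+1 = x + cs_mul x (s n) by [].
have sSr n : s n.+1 = x + cs_mul (s n) x.
  elim: n => [|n IH]; first by rewrite sS /= cs_mul0l cs_mul0r.
  by rewrite sS {1}IH cs_mulDr cs_mulA [s n.+1]sS cs_mulDl.
have step n : cs_norm (s n.+1 - s n) <= r ^+ n * r.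
  elim: n => [|n IH]; first by rewrite sS /= cs_mul0r addr0 subr0 mul1r.
  rewrite [s n.+2]sS [s n.+1 in X in _ - X]sS opprD addrACA subrr add0r -cs_mulBr.
  by rewrite (le_trans (cs_norm_mul _ _)) // exprS -mulrA ler_wpM2l.
have diff n k : cs_norm (s (n + k)%N - s n) * (1 - r) <= r ^+ n * r.
  (* The exact geometric sum, with its factor 1 - r^k, is what lets the induction on k close. *)
  suff : cs_norm (s (n + k)%N - s n) * (1 - r) <= r ^+ n * r * (1 - r ^+ k).
    move=> /le_trans; apply; rewrite ler_piMr ?mulr_ge0 ?exprn_ge0//.
    by rewrite lerBlDr lerDl exprn_ge0.
  elim: k => [|k IH]; first by rewrite addn0 subrr cs_norm0 mul0r expr0 subrr mulr0.
  have h : cs_norm (s (n + k.+1)%N - s n) * (1 - r) <=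
     (cs_norm (s (n + k).+1 - s (n + k)%N) + cs_norm (s (n + k)%N - s n)) * (1 - r).
    by rewrite addnS ler_wpM2r ?subr_ge0 ?(ltW x1)// cs_dist_triangle.
  apply: (le_trans h); rewrite mulrDl.
  have h2 : cs_norm (s (n + k).+1 - s (n + k)%N) * (1 - r) <= r ^+ (n + k) * r * (1 - r).
    by rewrite ler_wpM2r ?subr_ge0 ?(ltW x1).
  apply: le_trans (lerD h2 IH) _.
  by rewrite exprD exprS; move: (r ^+ n) (r ^+ k) => a b; lra.
have small (e : R) : 0 < e -> exists N, forall n, (N <= n)%N -> r ^+ n * r < e.
  move=> e0; have : r ^+ n @[n --> \oo] --> (0 : R) by apply: cvg_expr; rewrite ger0_norm.
  move=> /cvgr0_norm_lt /(_ _ e0)[N _ Nr]; exists N => n Nn.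
  have := Nr n Nn; rewrite /= ger0_norm ?exprn_ge0//.
  by apply: le_lt_trans; rewrite ler_piMr ?exprn_ge0 // ltW.
have [|l sl] := @cs_complete s.
  move=> e e0; have e1 : 0 < e * (1 - r) by rewrite mulr_gt0 ?subr_gt0.
  have [N Nr] := small _ e1.
  have key m n : (N <= m)%N -> (m <= n)%N -> cs_norm (s n - s m) < e.
    move=> Nm mn; rewrite -(@ltr_pM2r _ (1 - r)) ?subr_gt0//.
    by rewrite -(subnKC mn); exact: le_lt_trans (diff _ _) (Nr _ Nm).
  exists N => m n Nm Nn; case: (leqP n m) => mn; first exact: key.
  by rewrite cs_distC; apply: key => //; exact: ltnW.
have eqz (f : A -> A) :
    (forall y z, f y - f z = cs_mul x (y - z) \/ f y - f z = cs_mul (y - z) x) ->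
    (forall n, s n.+1 = f (s n)) -> l = f l.
  move=> fl fs; apply/eqP; rewrite -subr_eq0; apply/eqP; apply: cs_norm_small => e e0.
  have e2 : 0 < e / 2 by rewrite divr_gt0.
  have [N Nl] := sl _ e2.
  apply: le_trans (cs_dist_triangle (s N.+1) _ _) _.
  rewrite [e in X in _ <= X](splitr e); apply: lerD.
    by rewrite cs_distC ltW // Nl.
  have hN := Nl _ (leqnn N).
  have : cs_norm (f (s N) - f l) <= r * cs_norm (s N - l).
    by have [->|->] := fl (s N) l; rewrite 1?[r * _]mulrC ?cs_norm_mul // mulrC cs_norm_mul.
  rewrite fs => /le_trans; apply; rewrite (le_trans _ (ltW hN)) // ler_piMl ?cs_norm_ge0 // ltW //.
exists l; split.
- apply: (eqz (fun y => x + cs_mul x y)) => // y z; left.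
  by rewrite opprD addrACA subrr add0r cs_mulBr.
- apply: (eqz (fun y => x + cs_mul y x)) => // y z; right.
  by rewrite opprD addrACA subrr add0r cs_mulBl.
Qed.

(** Resolvent identity: since 1 + q and 1 + q' invert 1 - z x and 1 - w x, their difference is (z -
    w)(1 + q) x (1 + q'), here expanded to avoid the unit. *)
Lemma quasi_inverse_resolvent (z w : Cx R) x q q' :
  quasi_inverse (z *: x) q -> quasi_inverse (w *: x) q' ->
  q - q' = (z - w) *: (x + cs_mul x q' + cs_mul q x + cs_mul q (cs_mul x q')).
Proof.
move=> [_ qE] [q'E _].
have h1 : z *: (x + cs_mul q x) = q by rewrite scalerDr -cs_mulZr -qE.
have h2 : w *: (x + cs_mul x q') = q' by rewrite scalerDr -cs_mulZl -q'E.
have e1 : x + cs_mul x q' + cs_mul q x + cs_mul q (cs_mul x q') =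
   (x + cs_mul q x) + cs_mul (x + cs_mul q x) q'.
  by rewrite cs_mulDl cs_mulA addrA; congr (_ + _); rewrite addrAC.
have e2 : x + cs_mul x q' + cs_mul q x + cs_mul q (cs_mul x q') =
   (x + cs_mul x q') + cs_mul q (x + cs_mul x q') by rewrite cs_mulDr !addrA.
rewrite scalerBl {1}e1 e2 (scalerDr z) (scalerDr w) -cs_mulZl h1 -cs_mulZr h2.
by rewrite opprD addrACA subrr addr0.
Qed.

(** This is 1/(1 - x^2) = (1/(1 - x) + 1/(1 + x)) / 2 without unit; [s1] and [s2] relate the even
    part q + q' and the odd part q - q'. *)
Lemma quasi_inverse_sqr x q q' :
  quasi_inverse x q -> quasi_inverse (- x) q' ->
  quasi_inverse (cs_mul x x) ((2^-1 : Cx R) *: (q + q')).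
Proof.
have two : (2^-1 : Cx R) *: (x + x) = x.
  by rewrite scalerDr -scalerDl -[in RHS](scale1r x) [in RHS](splitr 1) div1r.
move=> [qE qE'] [q'E q'E']; rewrite /quasi_inverse cs_mulZr cs_mulZl; split.
- have s1 : q + q' = cs_mul x (q - q').
    by rewrite {1}qE {1}q'E cs_mulNl addrACA subrr add0r cs_mulBr.
  have s2 : q - q' = (x + x) + cs_mul x (q + q').
    by rewrite {1}qE {1}q'E cs_mulNl opprD !opprK addrACA cs_mulDr.
  have -> : (2^-1 : Cx R) *: (q + q') =
      (2^-1 : Cx R) *: (cs_mul x (x + x) + cs_mul (cs_mul x x) (q + q')).
    by rewrite {1}s1 s2 cs_mulDr cs_mulA.
  by rewrite scalerDr -cs_mulZr two.
- have s1 : q + q' = cs_mul (q - q') x.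
    by rewrite {1}qE' {1}q'E' cs_mulNr addrACA subrr add0r cs_mulBl.
  have s2 : q - q' = (x + x) + cs_mul (q + q') x.
    by rewrite {1}qE' {1}q'E' cs_mulNr opprD !opprK addrACA cs_mulDl.
  have -> : (2^-1 : Cx R) *: (q + q') =
      (2^-1 : Cx R) *: (cs_mul (x + x) x + cs_mul (q + q') (cs_mul x x)).
    by rewrite {1}s1 s2 cs_mulDl cs_mulA.
  by rewrite scalerDr -cs_mulZl two.
Qed.

(** With X = |x| and Q = |q| this reads Q <= X / (1 - X) if X < 1, and Q >= X / (1 + X): small
    elements have small quasi-inverses, large ones do not. *)
Lemma quasi_inverse_norm x q : quasi_inverse x q ->
  cs_norm q <= cs_norm x + cs_norm x * cs_norm q /\
  cs_norm x <= cs_norm q + cs_norm x * cs_norm q.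
Proof.
move=> [qE _]; split.
  by rewrite {1}qE (le_trans (cs_normD _ _))// lerD2l cs_norm_mul.
have -> : x = q - cs_mul x q by rewrite {1}qE addrK.
rewrite (le_trans (cs_normB _ _))// lerD2l -[X in _ <= cs_norm X * _](_ : x = _) ?cs_norm_mul//.
by rewrite {1}qE addrK.
Qed.

End CstarNorm.

(** * Automatic continuity of *-homomorphisms *)

Section AutomaticContinuity.
Variables (R : realType).

(** Compactness is applied to the square with corners at +-1 +-i, which contains the unit disc and
    lies in the disc of radius 2; hence the two radii. *)
Lemma square_bounded (f : Cx R -> R) :
  (forall z, Cnorm z <= 2 ->
     exists d M : R, 0 < d /\ forall w, Cnorm (w - z) < d -> f w <= M) ->
  exists M, forall z, Cnorm z <= 1 -> f z <= M.
Proof.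
move=> loc.
pose K : set (R * R) := `[(-1 : R), 1]%classic `*` `[(-1 : R), 1]%classic.
have Kc : compact K by apply: compact_setX; exact: segment_compact.
have /compact_near_coveringP/(_ _ (pinfty_nbhs R)
  (fun M z => f (Complex z.1 z.2) <= M)) := Kc.
case.
- move=> [x y] [/=]; rewrite !in_itv /= -!ler_norml => x1 y1.
  have [|d [M [d0 dM]]] := loc (Complex x y : Cx R).
    by apply: le_trans (Cnorm_le _ _) _; rewrite (_ : 2 = 1 + 1) ?lerD.
  exists (ball (x, y) (d / 2), [set M' | M < M']) => /=.
    split; first by apply: nbhsx_ballx; rewrite divr_gt0.
    by exists M; split; [exact: num_real|].
  move=> [[x' y'] M'] /= [[xx yy] MM]; apply: le_trans (ltW MM); apply: dM.
  have -> : (Complex x' y' : Cx R) - Complex x y = Complex (x' - x) (y' - y) by [].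
  apply: le_lt_trans (Cnorm_le _ _) _; rewrite [d]splitr ltrD//.
    by move: xx; rewrite /ball /= distrC.
  by move: yy; rewrite /ball /= distrC.
- move=> M [_ /(_ (M + 1))]; rewrite ltrDl ltr01 => /(_ isT) h; exists (M + 1) => z z1.
  have := h (complex.Re z, complex.Im z); rewrite /K /=; case: z z1 => a b z1; apply.
  by split; rewrite /= in_itv /= -ler_norml; apply: le_trans z1;
    [exact: (Cnorm_ge_Re (Complex a b))|exact: (Cnorm_ge_Im (Complex a b))].
Qed.

Variable B : cstarAlg R.
Implicit Types b : B.

Definition iter_sqr b k := iter k (fun x => cs_mul x x) b.

Lemma iter_sqr_star b k : cs_star b = b -> cs_star (iter_sqr b k) = iter_sqr b k.
Proof. by move=> sb; elim: k => //= k IH; rewrite cs_starM IH. Qed.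

Lemma iter_sqr_norm b k : cs_star b = b ->
  cs_norm (iter_sqr b k) = cs_norm b ^+ (2 ^ k).
Proof.
move=> sb; elim: k => [|k IH]; first by rewrite expn0 expr1.
by rewrite /= -{1}(iter_sqr_star k sb) cs_norm_sqr IH -exprM expnSr.
Qed.

(** The resolvent identity bounds |q w - q z| by D (1 + |q w|), with D <= 1/2 for w close to z, so
    |q w| <= 2 |q z| + 1. Compactness turns this local bound into a uniform M, and the identity then
    gives the Lipschitz constant. Radius 3 leaves room around the disc of radius 2. *)
Lemma quasi_inverse_bounded b :
  (forall z : Cx R, Cnorm z <= 3 -> exists q, quasi_inverse (z *: b) q) ->
  exists q (L : R), [/\ 0 <= L,
    (forall z : Cx R, Cnorm z <= 1 -> quasi_inverse (z *: b) (q z)) &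
    (forall z w : Cx R, Cnorm z <= 1 -> Cnorm w <= 1 ->
      cs_norm (q z - q w) <= L * Cnorm (z - w))].
Proof.
move=> hq.
have /choice[q qP] (z : Cx R) : exists q, Cnorm z <= 3 -> quasi_inverse (z *: b) q.
  by have [/hq[q ?]|z3] := leP (Cnorm z) 3; [exists q | exists 0 => z3'; lra].
have res z w : Cnorm z <= 3 -> Cnorm w <= 3 -> cs_norm (q z - q w) <=
    Cnorm (z - w) * (cs_norm b * ((1 + cs_norm (q z)) * (1 + cs_norm (q w)))).
  move=> z3 w3; rewrite (quasi_inverse_resolvent (qP _ z3) (qP _ w3)) cs_normZ.
  rewrite ler_wpM2l ?Cnorm_ge0//.
  set s := q z; set t := q w.
  have e1 : cs_norm (cs_mul b t) <= cs_norm b * cs_norm t := cs_norm_mul _ _.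
  have e2 : cs_norm (cs_mul s b) <= cs_norm s * cs_norm b := cs_norm_mul _ _.
  have e3 : cs_norm (cs_mul s (cs_mul b t)) <= cs_norm s * (cs_norm b * cs_norm t).
    by apply: le_trans (cs_norm_mul _ _) _; rewrite ler_wpM2l ?cs_norm_ge0.
  have h1 := cs_normD (b + cs_mul b t + cs_mul s b) (cs_mul s (cs_mul b t)).
  have h2 := cs_normD (b + cs_mul b t) (cs_mul s b).
  have h3 := cs_normD b (cs_mul b t).
  nra.
have [|M MP] := @square_bounded (fun z => cs_norm (q z)).
  move=> z z2; have b0 := cs_norm_ge0 b; have q0 := cs_norm_ge0 (q z).
  pose C := cs_norm b * (1 + cs_norm (q z)).
  have C0 : 0 <= C by rewrite mulr_ge0 // addr_ge0.
  exists (2 * (C + 1))^-1, (2 * cs_norm (q z) + 1); split.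
    by rewrite invr_gt0; lra.
  move=> w wz.
  have C1 : 0 < 2 * (C + 1) by lra.
  have wz' : Cnorm (w - z) * (2 * (C + 1)) < 1 by rewrite -ltr_pdivlMr // div1r.
  have w3 : Cnorm w <= 3.
    have := CnormD (w - z) z; rewrite subrK; have := Cnorm_ge0 (w - z); nra.
  have z3 : Cnorm z <= 3 by lra.
  have := res _ _ w3 z3; have := cs_normD (q w - q z) (q z); rewrite subrK.
  have := Cnorm_ge0 (w - z); have := cs_norm_ge0 (q w).
  rewrite -/C (_ : Cnorm (w - z) * _ = (Cnorm (w - z) * C) * (1 + cs_norm (q w)));
    last by rewrite /C; ring.
  have : Cnorm (w - z) * C <= 1 / 2 by have := Cnorm_ge0 (w - z); nra.
  by move: (Cnorm (w - z) * C) => D; nra.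
exists q, (cs_norm b * ((1 + M) * (1 + M))).
have M0 : 0 <= M by apply: le_trans (MP 0 _); rewrite ?cs_norm_ge0 // /Cnorm normr0.
split.
- by rewrite !mulr_ge0 ?cs_norm_ge0 ?addr_ge0.
- by move=> z z1; apply: qP; lra.
- move=> z w z1 w1; rewrite mulrC; apply: le_trans (res _ _ _ _) _; [lra|lra|].
  rewrite ler_wpM2l ?Cnorm_ge0// ler_wpM2l ?cs_norm_ge0//.
  by rewrite ler_pM ?addr_ge0 ?cs_norm_ge0 // lerD2l MP.
Qed.

(* Otherwise take t' < 1 / |b| < t very close to each other; the quasi-inverses of
   [t *: b] and [t' *: b] are then close, uniformly after rotation by a phase.
   Averaging over the two square roots of the phase transports this to the
   elements [t ^ (2 ^ k) *: b ^ (2 ^ k)] and [t' ^ (2 ^ k) *: b ^ (2 ^ k)]; but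
   the norm of the former tends to infinity and that of the latter to 0. *)
Lemma quasi_inverse_norm_le1 b : cs_star b = b ->
  (forall z : Cx R, Cnorm z <= 3 -> exists q, quasi_inverse (z *: b) q) ->
  cs_norm b <= 1.
Proof.
move=> sb /quasi_inverse_bounded[q [L [L0 qP qL]]].
rewrite leNgt; apply/negP => b1.
set n := cs_norm b in b1; pose c := n^-1.
have n0 : 0 < n by lra.
have c0 : 0 < c by rewrite invr_gt0.
have c1 : c < 1 by rewrite invf_lt1.
have cn : c * n = 1 by rewrite mulVf ?gt_eqF.
(* c + d <= 1 keeps both parameters in the disc of the Lipschitz bound; L * (2 * d) <= 1/2 makes the
   two quasi-inverses 1/2-close. *)
have [d [d0 dc dc1 dL]] : exists d : R, [/\ 0 < d, d <= c, c + d <= 1 & L * (2 * d) <= 1 / 2].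
  exists (Num.min c (Num.min (1 - c) (4 * (L + 1))^-1)).
  have L1 : 0 < 4 * (L + 1) by lra.
  have iL : (4 * (L + 1))^-1 * (4 * (L + 1)) = 1 by rewrite mulVf ?gt_eqF.
  have iL0 : 0 < (4 * (L + 1))^-1 by rewrite invr_gt0.
  by rewrite /Num.min; case: ifPn; case: ifPn; rewrite -?leNgt => ? ?; split; nra.
pose t := c + d; pose t' := c - d.
have t0 : 0 <= t by rewrite /t; lra.
have t'0 : 0 <= t' by rewrite /t'; lra.
have D k : forall w : Cx R, Cnorm w = 1 -> exists p p',
    [/\ quasi_inverse ((t%:C%C ^+ (2 ^ k) * w : Cx R) *: iter_sqr b k) p,
     quasi_inverse ((t'%:C%C ^+ (2 ^ k) * w : Cx R) *: iter_sqr b k) p' &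
     cs_norm (p - p') <= 1 / 2].
  elim: k => [|k IH] w w1.
    have tn : Cnorm (t%:C%C * w) = t by rewrite CnormM w1 mulr1 Cnorm_real ger0_norm /t; lra.
    have tn' : Cnorm (t'%:C%C * w) = t' by rewrite CnormM w1 mulr1 Cnorm_real ger0_norm /t'; lra.
    have dt : Cnorm (t%:C%C * w - t'%:C%C * w) = 2 * d.
      rewrite -mulrBl CnormM w1 mulr1 -(rmorphB (real_complex R)) Cnorm_real.
      by rewrite ger0_norm /t /t'; lra.
    exists (q (t%:C%C * w)), (q (t'%:C%C * w)); rewrite expn0 !expr1; split.
    - by apply: qP; rewrite tn /t; lra.
    - by apply: qP; rewrite tn' /t'; lra.
    - apply: le_trans (qL _ _ _ _) _; rewrite ?tn ?tn' ?dt // /t /t'; lra.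
  pose v := sqrtC w.
  have vv : v ^+ 2 = w by rewrite sqrtCK.
  have v1 : Cnorm v = 1.
    have : Cnorm v ^+ 2 == 1 by rewrite -Cnorm_sqr vv w1.
    by rewrite sqrf_eq1 => /orP[/eqP//|/eqP]; have := Cnorm_ge0 v; lra.
  have [p1 [p1' [h1 h1' b1']]] := IH v v1.
  have [|p2 [p2' [h2 h2' b2']]] := IH (- v); first by rewrite CnormN.
  exists ((2^-1 : Cx R) *: (p1 + p2)), ((2^-1 : Cx R) *: (p1' + p2')).
  have sq (s : R) : (s%:C%C ^+ (2 ^ k.+1) * w : Cx R) *: iter_sqr b k.+1 =
     cs_mul ((s%:C%C ^+ (2 ^ k) * v : Cx R) *: iter_sqr b k)
            ((s%:C%C ^+ (2 ^ k) * v : Cx R) *: iter_sqr b k).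
    by rewrite cs_mulZl cs_mulZr scalerA -expr2 exprMn vv -exprM -expnSr.
  split.
  - by rewrite sq; apply: (quasi_inverse_sqr h1); rewrite -scaleNr -mulrN; exact: h2.
  - by rewrite sq; apply: (quasi_inverse_sqr h1'); rewrite -scaleNr -mulrN; exact: h2'.
  - rewrite -scalerBr opprD addrACA cs_normZ.
    have -> : Cnorm (2^-1 : Cx R) = 2^-1.
      have -> : (2^-1 : Cx R) = (2^-1)%:C%C by rewrite fmorphV rmorphD.
      by rewrite Cnorm_real ger0_norm.
    have := cs_normD (p1 - p1') (p2 - p2'); lra.
pose h := d * n.
have h0 : 0 < h by rewrite mulr_gt0.
have bern k : 1 + k%:R * h <= (1 + h) ^+ k.
  elim: k => [|k IH]; first by rewrite mul0r addr0.
  rewrite exprS; have : (0 : R) <= k%:R by [].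
  by rewrite -natr1; nra.
(* With 5 the bounds contradict each other: |p| >= 5/6, while |p'| <= 1/4 and |p - p'| <= 1/2 give
   |p| <= 3/4. *)
have [k k5] : exists k, 5 <= (1 + h) ^+ (2 ^ k).
  have [m hm] : exists m : nat, 5 / h < m%:R.
    by exists (Num.bound (5 / h)); apply: archi_boundP; rewrite divr_ge0 // ltW.
  exists m; apply: le_trans (bern _).
  have : (m%:R : R) <= (2 ^ m)%:R by rewrite ler_nat ltnW // ltn_expl.
  move: hm; rewrite ltr_pdivrMr // => hm mk; nra.
have [|p [p' [pq pq' pp']]] := D k 1; first exact: Cnorm1.
have [_ x1] := quasi_inverse_norm pq; have [x2 _] := quasi_inverse_norm pq'.
have xn (s : R) : 0 <= s ->
    cs_norm ((s%:C%C ^+ (2 ^ k) * 1 : Cx R) *: iter_sqr b k) = (s * n) ^+ (2 ^ k).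
  move=> s0; rewrite cs_normZ mulr1 -rmorphXn Cnorm_real iter_sqr_norm //.
  by rewrite ger0_norm ?exprn_ge0 // exprMn.
have tn : t * n = 1 + h by rewrite /t mulrDl cn.
have tn' : t' * n = 1 - h by rewrite /t' mulrBl cn.
rewrite [cs_norm (_ *: _)](xn t t0) tn in x1.
rewrite [cs_norm (_ *: _)](xn t' t'0) tn' in x2; move: x1 x2.
have h1 : 0 <= 1 - h by rewrite -tn' mulr_ge0 // ltW.
have : (1 - h) ^+ (2 ^ k) * (1 + h) ^+ (2 ^ k) <= 1.
  by rewrite -exprMn exprn_ile1 //; nra.
have : 0 <= (1 - h) ^+ (2 ^ k) by rewrite exprn_ge0.
move: ((1 - h) ^+ (2 ^ k)) ((1 + h) ^+ (2 ^ k)) k5 => u v v5 u0 uv x1 x2.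
have u5 : u <= 1 / 5 by nra.
have := cs_norm_ge0 p; have := cs_norm_ge0 p'.
have := cs_normD (p - p') p'; rewrite subrK => pp.
have : cs_norm p' <= 1 / 4 by have := cs_norm_ge0 p'; nra.
by nra.
Qed.

(* The optimal constant is 1; any constant gives continuity. *)
Lemma star_hom_bounded (A : cstarAlg R) (f : A -> B) : is_star_hom f ->
  forall x, cs_norm (f x) <= 3 * cs_norm x.
Proof.
move=> [flin fM fS].
have f0 : f 0 = 0.
  by have := flin 1 0 0; rewrite scaler0 addr0 scale1r => /eqP;
    rewrite -[X in X == _]addr0 (inj_eq (addrI _)) => /eqP.
have fD x y : f (x + y) = f x + f y by have := flin 1 x y; rewrite !scale1r.
have fZ a x : f (a *: x) = a *: f x by have := flin a x 0; rewrite !addr0 f0 addr0.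
have sa x : cs_star x = x -> cs_norm (f x) <= 3 * cs_norm x.
  move=> sx; rewrite leNgt; apply/negP => lt.
  have x0 := cs_norm_ge0 x.
  pose D := cs_norm (f x) + 3 * cs_norm x.
  have D0 : 0 < D by rewrite /D; lra.
  (* If 3 |x| < |f x|, this scaling puts 1 strictly between 3 s |x| and s |f x|. Then z s x has a
     quasi-inverse for |z| <= 3, hence so has its image, which forces s |f x| <= 1. *)
  pose s := 2 / D.
  have sD : s * D = 2 by rewrite /s mulfVK ?gt_eqF.
  have s0 : 0 < s by rewrite divr_gt0.
  have ns (C : cstarAlg R) (y : C) : cs_norm ((s%:C%C : Cx R) *: y) = s * cs_norm y.
    by rewrite cs_normZ Cnorm_real gtr0_norm.
  have : cs_norm ((s%:C%C : Cx R) *: f x) <= 1.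
    apply: quasi_inverse_norm_le1.
      have := @cs_star_antilin R B (s%:C%C) (f x) 0.
      by rewrite !addr0 cs_star0 addr0 -fS sx => ->; congr (_ *: _); exact: conjc_real.
    move=> z z3; have [|q [q1 q2]] := @quasi_inverse_exists R A (z *: ((s%:C%C : Cx R) *: x)).
      rewrite cs_normZ ns.
      have : 0 < s * (cs_norm (f x) - 3 * cs_norm x) by rewrite mulr_gt0 ?subr_gt0.
      have : Cnorm z * (s * cs_norm x) <= 3 * (s * cs_norm x).
        by rewrite ler_wpM2r // mulr_ge0 // ltW.
      by move: sD; rewrite /D mulrBr mulrDr; lra.
    exists (f q); split; rewrite -!fZ -fM -fD; [by rewrite -q1|by rewrite -q2].
  rewrite ns; have : 0 < s * (cs_norm (f x) - 3 * cs_norm x) by rewrite mulr_gt0 ?subr_gt0.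
  by move: sD; rewrite /D mulrBr mulrDr; lra.
(* The C*-identity reduces to the self-adjoint case: |f x|^2 = |f (x* x)| <= 3 |x|^2 <= (3
   |x|)^2. *)
move=> x; have := sa (cs_mul (cs_star x) x).
rewrite cs_starM cs_starK => /(_ erefl); rewrite fM fS !cs_norm_sqr.
have := cs_norm_ge0 x; have := cs_norm_ge0 (f x); nra.
Qed.

End AutomaticContinuity.

(** * Unstable neighborhoods *)

Section Dynamics.
Variables (R : realType) (W : wielerData R).
Local Notation Y := (wY W).
Local Notation X := (solenoid W).
Local Notation g := (@wg R W).
Local Notation K := (wK W).
Local Notation gamma := (wgamma W).
Local Notation beta := (wbeta W).
Local Notation phi := (@phi R W).
Local Notation phi_inv := (@phi_inv R W).
Implicit Types x y z u v a b s t : X.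

Lemma coord_phi x n : sol_coord (phi x) n = g (sol_coord x n).
Proof. by case: n => [//|n] /=; rewrite solenoidP. Qed.

Lemma coord_iter_phi k x n : sol_coord (iter k phi x) n = iter k g (sol_coord x n).
Proof. by elim: k => // k IH; rewrite iterS coord_phi IH. Qed.

Lemma coord_iter_phi_inv k x n : sol_coord (iter k phi_inv x) n = sol_coord x (n + k)%N.
Proof. by elim: k n => [|k IH] n; rewrite ?addn0 //= IH addSnnS. Qed.

Lemma iter_coord x n k : iter k g (sol_coord x (n + k)%N) = sol_coord x n.
Proof. by elim: k => [|k IH]; rewrite ?addn0 // iterSr addnS solenoidP. Qed.

Lemma iter_coord0 x k : iter k g (sol_coord x k) = sol_coord x 0.
Proof. exact: (iter_coord x 0). Qed.

Lemma iter_phiK k : cancel (iter k phi) (iter k phi_inv).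
Proof. by elim: k => // k IH x; rewrite iterSr /= phiK IH. Qed.

Lemma iter_phi_invK k : cancel (iter k phi_inv) (iter k phi).
Proof. by elim: k => // k IH x; rewrite iterSr /= phi_invK IH. Qed.

Lemma mdistC (p q : Y) : mdist p q = mdist q p.
Proof. exact: metric_sym. Qed.

Lemma mdist_triangle (r p q : Y) : mdist p q <= mdist p r + mdist r q.
Proof. exact: metric_triangle. Qed.

Lemma wg_unif_continuous (e : R) : 0 < e ->
  exists2 d : R, 0 < d & forall p q : Y, mdist p q < d -> mdist (g p) (g q) < e.
Proof.
move=> e0.
have /compact_near_coveringP/(_ _ (0 : R)^'+
  (fun d p => forall q, mdist p q < d -> mdist (g p) (g q) < e)) := @wY_compact R W.
case.
- move=> p _; have /nbhs_ballP[r /= r0 pr] : nbhs p (g @^-1` ball (g p) (e / 2)).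
    by apply: wg_continuous; apply: nbhsx_ballx; rewrite divr_gt0.
  exists (ball p (r / 2), [set d | d < r / 2]) => /=.
    split; first by apply: nbhsx_ballx; rewrite divr_gt0.
    by apply: nbhs_right_lt; rewrite divr_gt0.
  move=> [p' d] /= [pp' dr] q p'q.
  move: pp'; rewrite ballEmdist /= => pp'.
  have h1 : mdist (g p) (g p') < e / 2.
    by have := pr p'; rewrite !ballEmdist /=; apply; lra.
  have h2 : mdist (g p) (g q) < e / 2.
    have := pr q; rewrite !ballEmdist /=; apply.
    by apply: le_lt_trans (mdist_triangle p' _ _) _; lra.
  have := mdist_triangle (g p) (g p') (g q); rewrite (mdistC (g p') (g p)); lra.
- move=> d /= d0 h; exists (d / 2); first by rewrite divr_gt0.
  have := h (d / 2); rewrite /= sub0r normrN ger0_norm ?divr_ge0 1?ltW //.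
  rewrite gtr_pMr // invf_lt1 // ltr1n => /(_ isT).
  by rewrite divr_gt0 // => /(_ isT) h' p q; apply: h'.
Qed.

Lemma iter_wg_unif_continuous N (e : R) : 0 < e ->
  exists2 d : R, 0 < d &
    forall i (p q : Y), (i <= N)%N -> mdist p q < d -> mdist (iter i g p) (iter i g q) < e.
Proof.
elim: N e => [|N IH] e e0.
  by exists e => // -[].
have [d1 d10 h1] := wg_unif_continuous e0.
have [d d0 h] := IH _ d10; have [d' d'0 h'] := IH _ e0.
exists (Num.min d d'); first by rewrite lt_min d0.
move=> i p q; rewrite leq_eqVlt => /orP[/eqP-> |iN]; rewrite lt_min => /andP[pq pq'].
  by rewrite /=; apply/h1/h.
exact: h'.
Qed.

Lemma mdist_bounded : exists2 D : R, 0 < D & forall p q : Y, mdist p q <= D.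
Proof.
have [p0 _] : exists p : Y, True.
  apply: contrapT => /forallNP h; apply: (@wY_infinite _ W).
  by rewrite (_ : [set: Y] = set0) //; apply/seteqP; split => // p /h.
have /compact_near_coveringP/(_ _ (pinfty_nbhs R)
  (fun M p => mdist p0 p <= M)) := @wY_compact R W.
case.
- move=> p _; exists (ball p 1, [set M | mdist p0 p + 1 < M]) => /=.
    by split; [exact: nbhsx_ballx|exists (mdist p0 p + 1); split; [exact: num_real|]].
  move=> [q M] /= []; rewrite ballEmdist /= => pq M1.
  by apply: le_trans (mdist_triangle p _ _) _; lra.
- move=> M [_ h]; exists (2 * (`|M| + 1)).
    by rewrite mulr_gt0 // ltr_wpDl.
  move=> p q.
  have M1 : M < `|M| + 1 by rewrite ltr_pwDr // ler_norm.
  have hp := h _ M1 p I; have hq := h _ M1 q I.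
  by apply: le_trans (mdist_triangle p0 _ _) _; rewrite /= in hp hq; rewrite (mdistC p p0); lra.
Qed.

(** The part of [Xu] that does not mention [dX]. It obeys a triangle inequality and is preserved by
    [phi_inv] with the same e, since [phi_inv] only drops a coordinate; it defines the same small
    neighborhoods ([near_pt_Xu], [Xu_near_pt]). *)
Definition near_pt (e : R) x y := forall n, mdist (sol_coord x n) (sol_coord y n) < e.

Lemma near_ptxx e x : 0 < e -> near_pt e x x.
Proof. by move=> e0 n; rewrite mdistxx. Qed.

Lemma near_ptC e x y : near_pt e x y -> near_pt e y x.
Proof. by move=> xy n; rewrite mdistC. Qed.

Lemma near_pt_trans y e e' x z : near_pt e x y -> near_pt e' y z -> near_pt (e + e') x z.
Proof.
move=> xy yz n; apply: le_lt_trans (mdist_triangle (sol_coord y n) _ _) _.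
exact: ltrD.
Qed.

Lemma near_ptW e e' x y : e <= e' -> near_pt e x y -> near_pt e' x y.
Proof. by move=> ee xy n; exact: lt_le_trans (xy n) ee. Qed.

Lemma near_pt_phi_inv k e x y : near_pt e x y -> near_pt e (iter k phi_inv x) (iter k phi_inv y).
Proof. by move=> xy n; rewrite !coord_iter_phi_inv. Qed.

Lemma near_pt_iter_phi N e : 0 < e -> exists2 d : R, 0 < d &
  forall i x y, (i <= N)%N -> near_pt d x y -> near_pt e (iter i phi x) (iter i phi y).
Proof.
move=> e0; have [d d0 h] := iter_wg_unif_continuous N e0.
by exists d => // i x y iN xy n; rewrite !coord_iter_phi; apply: h.
Qed.

Lemma gamma_ge0 : 0 <= gamma. Proof. exact/ltW/wgamma_gt0. Qed.

Lemma dX'_le x y (e : R) :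
  (forall n, gamma ^+ n * mdist (sol_coord x n) (sol_coord y n) <= e) -> dX' x y <= e.
Proof.
move=> h; apply: ge_sup; first by eexists; exists 0%N.
by move=> _ [n _ <-].
Qed.

Lemma dX'_ge x y n : gamma ^+ n * mdist (sol_coord x n) (sol_coord y n) <= dX' x y.
Proof.
have [D D0 hD] := mdist_bounded.
apply: ub_le_sup; last by exists n.
exists D => _ [m _ <-]; rewrite -[D]mul1r ler_pM ?exprn_ge0 ?mdist_ge0 ?gamma_ge0//.
by rewrite exprn_ile1 ?gamma_ge0 // ltW // wgamma_lt1.
Qed.

Lemma dX'_ge0 x y : 0 <= dX' x y.
Proof. by apply: le_trans (dX'_ge x y 0); rewrite expr0 mul1r mdist_ge0. Qed.

Lemma dX_ge0 x y : 0 <= dX x y.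
Proof. by apply: sumr_ge0 => i _; rewrite mulr_ge0 ?exprn_ge0 ?gamma_ge0 // dX'_ge0. Qed.

Lemma dX_ge x y : mdist (sol_coord x 0) (sol_coord y 0) <= dX x y.
Proof.
rewrite /dX big_nat_recl // expr0 mul1r /=.
apply: ler_wpDr.
  by apply: sumr_ge0 => i _; rewrite mulr_ge0 ?exprn_ge0 ?gamma_ge0 // dX'_ge0.
by have := dX'_ge x y 0; rewrite expr0 mul1r.
Qed.

Lemma dX_small (e : R) : 0 < e -> exists N (d : R), 0 < d /\ forall x y,
  (forall n, (n <= N)%N -> mdist (sol_coord x n) (sol_coord y n) < d) -> dX x y < e.
Proof.
move=> e0; have [D D0 hD] := mdist_bounded.
(* The sum has K + 1 terms, each at most e1; dividing by K + 2 makes the total strictly smaller than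
   e. *)
pose e1 := e / K.+2%:R.
have e10 : 0 < e1 by rewrite divr_gt0.
have [N hN] : exists N, gamma ^+ N * D < e1.
  have : gamma ^+ n @[n --> \oo] --> (0 : R).
    by apply: cvg_expr; rewrite ger0_norm ?gamma_ge0 ?wgamma_lt1.
  have eD : 0 < e1 / D by rewrite divr_gt0.
  move=> /cvgr0_norm_lt /(_ _ eD)[N _ /(_ N)] /=; rewrite leqnn => /(_ isT).
  by rewrite ger0_norm ?exprn_ge0 ?gamma_ge0 // ltr_pdivlMr // => h; exists N.
have [d d0 hd] := iter_wg_unif_continuous K e10.
exists N, d; split => // x y xy.
have gn1 n : gamma ^+ n <= 1 by rewrite exprn_ile1 ?gamma_ge0 // ltW // wgamma_lt1.
have step i : (i <= K)%N -> gamma ^+ i * dX' (iter i phi x) (iter i phi y) <= e1.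
  move=> iK; rewrite -[e1]mul1r ler_pM ?exprn_ge0 ?gamma_ge0 ?dX'_ge0 //.
  apply: dX'_le => n; rewrite !coord_iter_phi.
  have [nN|nN] := leqP n N.
    rewrite -[e1]mul1r ler_pM ?exprn_ge0 ?gamma_ge0 ?mdist_ge0 //.
    by apply: ltW; apply: hd => //; apply: xy.
  apply: le_trans (ltW hN); rewrite ler_pM ?exprn_ge0 ?gamma_ge0 ?mdist_ge0 //.
  by rewrite -(subnKC (ltnW nN)) exprD ler_piMr ?exprn_ge0 ?gamma_ge0.
have : dX x y <= \sum_(0 <= i < K.+1) e1.
  rewrite /dX !big_mkord; apply: ler_sum => i _; apply: step.
  by rewrite -ltnS.
move=> /le_lt_trans; apply; rewrite sumr_const_nat subn0 -mulr_natr /e1.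
rewrite mulrAC ltr_pdivrMr // ltr_pM2l // ltr_nat //.
Qed.

Lemma near_pt_dX (e : R) : 0 < e -> exists2 d : R, 0 < d &
  forall x y, near_pt d x y -> dX x y < e.
Proof.
by move=> /dX_small[N [d [d0 h]]]; exists d => // x y xy; apply: h => n _.
Qed.

Lemma near_pt_Xu (e : R) : 0 < e -> exists2 d : R, 0 < d &
  forall x y, near_pt d x y -> Xu x e y.
Proof.
move=> e0; have [d d0 h] := near_pt_dX e0; exists (Num.min d e); first by rewrite lt_min d0.
move=> x y xy; split; first by apply: near_ptW xy; rewrite ge_min lexx orbT.
by apply: h; apply: near_ptW xy; rewrite ge_min lexx.
Qed.

Lemma Xu_near_pt e x y : Xu x e y -> near_pt e x y.
Proof. by case. Qed.

(** Axiom 1 at the coordinates n + 2K, whose images under g^K and g^(2K) are the coordinates n + K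
    and n. *)
Lemma near_pt_contract x y n : (forall n, mdist (sol_coord x n) (sol_coord y n) <= beta) ->
  mdist (sol_coord x (n + K)) (sol_coord y (n + K)) <=
  gamma ^+ K * mdist (sol_coord x n) (sol_coord y n).
Proof.
move=> xy; have := wieler_axiom1 (xy (n + 2 * K)%N).
by rewrite !iter_coord mul2n -addnn addnA !iter_coord.
Qed.

Lemma near_pt_contractW x y n : (forall n, mdist (sol_coord x n) (sol_coord y n) <= beta) ->
  mdist (sol_coord x (n + K)) (sol_coord y (n + K)) <=
  mdist (sol_coord x n) (sol_coord y n).
Proof.
move=> xy; apply: le_trans (near_pt_contract n xy) _.
by rewrite ler_piMl ?mdist_ge0 // exprn_ile1 ?gamma_ge0 // ltW // wgamma_lt1.
Qed.

(** Along multiples of K the distances do not increase; any other coordinate is the image of the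
    next multiple of K under at most K iterates of g, which are uniformly continuous. *)
Lemma near_pt_of_coord0 (e : R) : 0 < e -> exists2 d : R, 0 < d & forall x y,
  (forall n, mdist (sol_coord x n) (sol_coord y n) <= beta) ->
  mdist (sol_coord x 0) (sol_coord y 0) < d -> near_pt e x y.
Proof.
move=> e0; have [d d0 hd] := iter_wg_unif_continuous K e0.
exists d => // x y xy xy0 n.
have mult k : mdist (sol_coord x (k * K)) (sol_coord y (k * K)) < d.
  elim: k => [|k IH]; first by rewrite mul0n.
  by rewrite mulSn addnC; exact: le_lt_trans (near_pt_contractW _ xy) IH.
have K0 := wK_ge1 W.
pose k := (n %/ K).+1; have nk : (n <= k * K)%N by rewrite ltnW // ltn_ceil.
have nk' : (k * K - n <= K)%N.
  by rewrite leq_subLR mulSn addnC leq_add2r leq_trunc_div.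
have := hd (k * K - n)%N _ _ nk' (mult k).
by rewrite -{2 4}(subnKC nk) !iter_coord.
Qed.

Lemma near_pt_inj x y : (forall n, mdist (sol_coord x n) (sol_coord y n) <= beta) ->
  sol_coord x 0 = sol_coord y 0 -> x = y.
Proof.
move=> xy xy0; apply: solenoid_eq => n; apply: mdist_positivity; apply/eqP.
rewrite eq_le mdist_ge0 andbT; apply/ler_addgt0Pl => e e0; rewrite addr0.
have [d d0 h] := near_pt_of_coord0 e0.
by apply: ltW; apply: (h x y xy); rewrite xy0 mdistxx.
Qed.

(** Axiom 2, iterated, yields w_0 = v, w_1, ... with w_n close to the coordinate (n + 1)K of y and
    g^(2K) w_(n+1) = g^K w_n. The w_n need not form a thread, but the g^K w_n do; this is where K
    iterates are lost. *)
Lemma near_pt_ext (e : R) : 0 < e -> exists2 d : R, 0 < d & forall y (v : Y),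
  mdist (sol_coord y K) v < d -> exists2 u, near_pt e y u & sol_coord u 0 = iter K g v.
Proof.
move=> e0; have [d0 d00 hd] := iter_wg_unif_continuous (2 * K) e0.
pose d := Num.min d0 beta.
have dd0 : d <= d0 by rewrite ge_min lexx.
have db : d <= beta by rewrite ge_min lexx orbT.
have d_gt0 : 0 < d by rewrite lt_min d00 wbeta_gt0.
exists d => // y v yv.
have gn1 n : gamma ^+ n <= 1 by rewrite exprn_ile1 ?gamma_ge0 // ltW // wgamma_lt1.
have K0 := wK_ge1 W.
have step n (w : Y) : exists w', mdist (sol_coord y (n.+1 * K)) w < gamma ^+ n * d ->
    mdist (sol_coord y (n.+2 * K)) w' < gamma ^+ n.+1 * d /\ iter (2 * K) g w' = iter K g w.
  have [yw|yw] := ltP (mdist (sol_coord y (n.+1 * K)) w) (gamma ^+ n * d); last first.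
    by exists w.
  have e1 : 0 < gamma ^+ n * d by rewrite mulr_gt0 ?exprn_gt0 ?wgamma_gt0.
  have e2 : gamma ^+ n * d <= beta.
    by apply: le_trans db; rewrite ler_piMl // ltW.
  have := @wieler_axiom2 _ W (sol_coord y (n.+2 * K)) _ e1 e2 (iter K g w).
  case; first by exists w => //; rewrite ballEmdist /= mulSn addnC iter_coord.
  by move=> w'; rewrite ballEmdist /= mulrA -exprS => h1 h2; exists w'.
have /choice[F hF] (nw : nat * Y) := step nw.1 nw.2.
(* [g^K (w n)] will be the coordinate [n * K] of the lift. *)
pose fix w n : Y := if n is m.+1 then F (m, w m) else v.
have wy n : mdist (sol_coord y (n.+1 * K)) (w n) < gamma ^+ n * d.
  elim: n => [|n IH]; first by rewrite mul1n expr0 mul1r.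
  exact: (hF (n, w n) IH).1.
have wS n : iter (2 * K) g (w n.+1) = iter K g (w n) := (hF (n, w n) (wy n)).2.
(* Coordinate j computed from level n; it does not depend on n once j <= n K, and n = j is allowed
   because K >= 1. *)
pose c n j := iter (n * K - j) g (iter K g (w n)).
have cS n j : (j <= n * K)%N -> c n.+1 j = c n j.
  move=> jn; rewrite /c mulSn addnC -addnBAC // iterD; congr (iter _ g _).
  by rewrite -iterD addnn -mul2n wS.
have cD n m j : (j <= n * K)%N -> c (m + n)%N j = c n j.
  move=> jn; elim: m => // m IH; rewrite addSn cS //.
  by apply: leq_trans jn _; rewrite leq_mul2r leq_addl orbT.
have cE n m j : (j <= n * K)%N -> (j <= m * K)%N -> c n j = c m j.
  move=> jn jm; have [nm|mn] := leqP n m; first by rewrite -(subnK nm) cD.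
  by rewrite -(subnK (ltnW mn)) cD.
have jK j : (j <= j * K)%N by rewrite leq_pmulr.
have cP j : g (c j.+1 j.+1) = c j j.
  have -> : g (c j.+1 j.+1) = c j.+1 j by rewrite /c -iterS -subSn ?jK // subSS.
  by apply: cE => //; rewrite (leq_trans (jK j)) // leq_mul2r leqnSn orbT.
exists (Solenoid cP) => /=; last by rewrite /c mul0n subn0.
move=> j /=; pose n := (j %/ K).+1; have jn : (j <= n * K)%N by rewrite ltnW // ltn_ceil.
have nj : (n * K - j <= K)%N.
  by rewrite leq_subLR mulSn addnC leq_add2r leq_trunc_div.
rewrite (cE j n) // /c -iterD.
have -> : sol_coord y j = iter (n * K - j + K) g (sol_coord y (n.+1 * K)).
  by rewrite iterD mulSn [(K + _)%N]addnC iter_coord -{2}(subnKC jn) iter_coord.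
apply: hd; first by rewrite mul2n -addnn leq_add2r.
apply: lt_le_trans (wy n) _; apply: le_trans dd0.
by rewrite ler_piMl // ltW.
Qed.

End Dynamics.

(** * Germs of unstable sets in Y *)

Section Germs.
Variables (R : realType) (W : wielerData R).
Local Notation Y := (wY W).
Local Notation X := (solenoid W).
Local Notation g := (@wg R W).
Local Notation K := (wK W).
Local Notation gamma := (wgamma W).
Local Notation beta := (wbeta W).
Local Notation phi := (@phi R W).
Local Notation phi_inv := (@phi_inv R W).
Implicit Types x y z u v a b s t : X.

Lemma betaP : 0 < beta. Proof. exact: wbeta_gt0. Qed.

Lemma near_pt_le_beta e z x y : e <= beta / 2 -> near_pt e z x -> near_pt e z y ->
  forall n, mdist (sol_coord x n) (sol_coord y n) <= beta.
Proof.
move=> eb zx zy n; have := near_pt_trans (near_ptC zx) zy n; lra.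
Qed.

Lemma dX_triangle y x z : dX x z <= dX x y + dX y z.
Proof.
rewrite /dX -big_split /=; apply: ler_sum => i _; rewrite -mulrDr.
rewrite ler_wpM2l ?exprn_ge0 ?gamma_ge0//; apply: dX'_le => n.
apply: le_trans (lerD (dX'_ge _ _ n) (dX'_ge _ _ n)); rewrite -mulrDr.
by rewrite ler_wpM2l ?exprn_ge0 ?gamma_ge0// mdist_triangle.
Qed.

(** The difficulty is that infinitely many strict inequalities might leave no margin. Contraction
    bounds the distance at n by that at n - K, so the maximum e' < e over the first K coordinates
    bounds them all. *)
Lemma Xu_open x (e : R) s : e <= epsX W -> Xu x e s ->
  exists2 d : R, 0 < d & forall t, near_pt d s t -> Xu x e t.
Proof.
move=> eb [xs dxs].
have xsb n : mdist (sol_coord x n) (sol_coord s n) <= beta.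
  by have := xs n; have := betaP; move: eb; rewrite /epsX; lra.
have [e' e'e he'] : exists2 e', e' < e &
    forall n, (n < K)%N -> mdist (sol_coord x n) (sol_coord s n) <= e'.
  elim: (K) => [|N [e' e'e IH]]; first by exists (e - 1) => //; rewrite gtrDl oppr_lt0.
  exists (Num.max e' (mdist (sol_coord x N) (sol_coord s N))); first by rewrite gt_max e'e xs.
  by move=> n; rewrite ltnS leq_eqVlt le_max => /orP[/eqP->|/IH->//]; rewrite lexx orbT.
have h n : mdist (sol_coord x n) (sol_coord s n) <= e'.
  have [k kn] := ubnP n; elim: k n kn => // k IH n nk.
  have [nK|Kn] := ltnP n K; first exact: he'.
  rewrite -(subnK Kn); apply: le_trans (near_pt_contractW _ xsb) (IH _ _).
  by have := wK_ge1 W; lia.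
have ed : 0 < e - dX x s by rewrite subr_gt0.
have [d d0 hd] := near_pt_dX W ed.
exists (Num.min d (e - e')); first by rewrite lt_min d0 subr_gt0.
move=> t st; split.
  move=> n; apply: le_lt_trans (mdist_triangle (sol_coord s n) _ _) _.
  have := h n; have := st n; rewrite lt_min => /andP[_]; lra.
apply: le_lt_trans (dX_triangle s _ _) _.
have : dX s t < e - dX x s by apply: hd => n; have := st n; rewrite lt_min => /andP[].
by lra.
Qed.

(** Inclusion of germs at the zeroth coordinate: the image in Y of a small unstable neighborhood of
    x is contained in that of any prescribed one of y. *)
Definition covers x y := forall e : R, 0 < e -> exists2 d : R, 0 < d &
  forall s, near_pt d x s -> exists2 u, near_pt e y u & sol_coord u 0 = sol_coord s 0.

Definition same_germ x y := [/\ sol_coord x 0 = sol_coord y 0, covers x y & covers y x].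

Lemma covers_trans y x z : covers x y -> covers y z -> covers x z.
Proof.
move=> xy yz e /yz[d d0 hd]; have [d' d'0 hd'] := xy _ d0.
by exists d' => // s /hd'[u /hd[v ? vu] us]; exists v => //; rewrite vu.
Qed.

Lemma same_germ_sym x y : same_germ x y -> same_germ y x.
Proof. by case. Qed.

Lemma same_germ_trans y x z : same_germ x y -> same_germ y z -> same_germ x z.
Proof.
move=> [xy c1 c2] [yz c3 c4]; split; first by rewrite xy.
  exact: covers_trans c3.
exact: covers_trans c2.
Qed.

Lemma covers_phi x y : covers x y -> covers (phi x) (phi y).
Proof.
move=> xy e e0; have [d d0 hd] := near_pt_iter_phi W 1 e0.
have [d' d'0 hd'] := xy _ d0.
exists d' => // s /(near_pt_phi_inv 1); rewrite /= phiK => /hd'[u yu us].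
exists (phi u); first exact: (hd 1%N).
by rewrite coord_phi us /= solenoidP.
Qed.

Lemma same_germ_phi x y : same_germ x y -> same_germ (phi x) (phi y).
Proof.
by move=> [xy c1 c2]; split; [rewrite !coord_phi xy|exact: covers_phi|exact: covers_phi].
Qed.

(** For s near x, the coordinate s_K is close to x_K = y_K, so it lifts to a point u near y with u_0
    = g^K s_K = s_0. *)
Lemma covers_coordK x y : sol_coord x K = sol_coord y K -> covers x y.
Proof.
move=> xy e e0; have [d d0 hd] := near_pt_ext W e0.
exists d => // s xs; have [|u yu us] := hd y (sol_coord s K); first by rewrite -xy.
by exists u => //; rewrite us iter_coord0.
Qed.

(** A point v near b is near y, so it has a lift t near x. Both a and t are unstably near x and
    their zeroth coordinates are close, so t is in fact near a. *)
Lemma covers_open x y : covers y x -> exists2 e : R, 0 < e &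
  forall a b, near_pt e x a -> near_pt e y b -> sol_coord a 0 = sol_coord b 0 -> covers b a.
Proof.
have b0 := betaP.
move=> /(_ (beta / 4)) []; first by lra.
move=> d d0 hd; pose e0 := Num.min (d / 2) (beta / 4).
have e1 : e0 <= d / 2 by rewrite ge_min lexx.
have e2 : e0 <= beta / 4 by rewrite ge_min lexx orbT.
exists e0; first by rewrite lt_min; lra.
move=> a b xa yb ab e e_gt0; have [d' d'0 hd'] := near_pt_of_coord0 W e_gt0.
exists (Num.min d' (d / 2)); first by rewrite lt_min; lra.
move=> v bv; have [|t xt tv] := hd v.
  apply: near_ptW (near_pt_trans yb bv).
  have : Num.min d' (d / 2) <= d / 2 by rewrite ge_min lexx orbT.
  by lra.
exists t => //; apply: hd'.
  by apply: near_pt_le_beta (near_ptW e2 xa) xt; lra.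
by rewrite tv ab; have := bv 0%N; rewrite lt_min => /andP[].
Qed.

Lemma same_germ_open x y : same_germ x y -> exists2 e : R, 0 < e &
  forall a b, near_pt e x a -> near_pt e y b -> sol_coord a 0 = sol_coord b 0 -> same_germ a b.
Proof.
move=> [_ /covers_open[e e0 h] /covers_open[e' e'0 h']].
exists (Num.min e e'); first by rewrite lt_min e0.
have m1 : Num.min e e' <= e by rewrite ge_min lexx.
have m2 : Num.min e e' <= e' by rewrite ge_min lexx orbT.
move=> a b xa yb ab; split => //.
  by apply: (h b a) => //; [exact: near_ptW yb|exact: near_ptW xa].
by apply: (h' a b) => //; [exact: near_ptW xa|exact: near_ptW yb].
Qed.

Lemma sim_uP x y : sim_u x y <->
  forall e : R, 0 < e ->
    exists N, forall n, (N <= n)%N -> mdist (sol_coord x n) (sol_coord y n) < e.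
Proof.
split.
- move=> xy e e0; have /cvgr0_norm_lt /(_ _ e0)[N _ h] := xy.
  exists N => n /h /=; rewrite ger0_norm ?dX_ge0 //.
  apply: le_lt_trans; have := dX_ge (iter n phi_inv x) (iter n phi_inv y).
  by rewrite !coord_iter_phi_inv.
- move=> h; apply/cvgr0Pnorm_lt => e e0; have [d d0 hd] := near_pt_dX W e0.
  have [N hN] := h _ d0; exists N => // n /= Nn; rewrite ger0_norm ?dX_ge0 //.
  by apply: hd => m; rewrite !coord_iter_phi_inv; apply: hN; rewrite (leq_trans Nn) // leq_addl.
Qed.

Lemma gammaK_small (e D : R) : 0 < e -> exists j, (gamma ^+ K) ^+ j * D < e.
Proof.
move=> e0; pose D' := `|D| + 1.
have D0 : 0 < D' by rewrite ltr_wpDl.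
have : (gamma ^+ K) ^+ n @[n --> \oo] --> (0 : R).
  apply: cvg_expr; rewrite ger0_norm ?exprn_ge0 ?gamma_ge0 //.
  by rewrite exprn_ilt1 ?gamma_ge0 ?wgamma_lt1 // -lt0n wK_ge1.
have eD : 0 < e / D' by rewrite divr_gt0.
move=> /cvgr0_norm_lt /(_ _ eD)[N _ /(_ N)] /=; rewrite leqnn => /(_ isT).
rewrite ger0_norm ?exprn_ge0 ?gamma_ge0 // ltr_pdivlMr // => h; exists N.
apply: le_lt_trans h; rewrite ler_wpM2l ?exprn_ge0 ?gamma_ge0 //.
by have := ler_norm D; rewrite /D'; lra.
Qed.

Lemma near_pt_sim_u x y : (forall n, mdist (sol_coord x n) (sol_coord y n) <= beta) -> sim_u x y.
Proof.
move=> xy; apply/sim_uP => e e0; have [D D0 hD] := mdist_bounded W.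
have [j hj] := gammaK_small D e0.
exists (j * K)%N => n jn; apply: le_lt_trans hj.
have key i m : mdist (sol_coord x (m + i * K)) (sol_coord y (m + i * K)) <= (gamma ^+ K) ^+ i * D.
  elim: i => [|i IH]; first by rewrite mul1r hD.
  rewrite mulSn [(K + _)%N]addnC addnA exprS -mulrA.
  apply: le_trans (near_pt_contract _ xy) _.
  by rewrite ler_wpM2l ?exprn_ge0 ?gamma_ge0.
by rewrite -(subnK jn).
Qed.

Lemma sim_u_trans y x z : sim_u x y -> sim_u y z -> sim_u x z.
Proof.
move=> /sim_uP xy /sim_uP yz; apply/sim_uP => e e0; have e2 : 0 < e / 2 by rewrite divr_gt0.
have [N hN] := xy _ e2; have [M hM] := yz _ e2.
exists (maxn N M) => n; rewrite geq_max => /andP[/hN h1 /hM h2].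
by apply: le_lt_trans (mdist_triangle (sol_coord y n) _ _) _; lra.
Qed.

(** Expansivity: once the iterates stay within beta, axiom 1 bounds their distance by gamma^K times
    the distance K steps later, hence by arbitrarily high powers of gamma^K. Conversely, equality
    after m steps makes any finite number of coordinates of phi^n x and phi^n y agree for large
    n. *)
Lemma sim_sP x y : sim_s x y <-> exists m, iter m g (sol_coord x 0) = iter m g (sol_coord y 0).
Proof.
split.
- move=> /cvgr0_norm_lt /(_ _ betaP)[N _ h].
  have {}h n : (N <= n)%N -> mdist (iter n g (sol_coord x 0)) (iter n g (sol_coord y 0)) <= beta.
    move=> /h /=; rewrite ger0_norm ?dX_ge0 // => /ltW; apply: le_trans.
    by rewrite -!coord_iter_phi; exact: dX_ge.
  exists (K + N)%N; apply: mdist_positivity; apply/eqP.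
  rewrite eq_le mdist_ge0 andbT; apply/ler_addgt0Pl => e e0; rewrite addr0.
  have [D D0 hD] := mdist_bounded W; have [j hj] := gammaK_small D e0.
  apply: le_trans (ltW hj).
  (* M is generalized because each use of axiom 1 moves it forward by K. *)
  clear hj; have : forall M, (N <= M)%N ->
      mdist (iter (K + M) g (sol_coord x 0)) (iter (K + M) g (sol_coord y 0)) <=
      (gamma ^+ K) ^+ j * D.
    elim: j => [|j IH] M NM; first by rewrite mul1r hD.
    have := wieler_axiom1 (h _ NM); rewrite -!iterD => /le_trans; apply.
    rewrite exprS -mulrA ler_wpM2l ?exprn_ge0 ?gamma_ge0 // mul2n -addnn -addnA.
    by apply: IH; rewrite (leq_trans NM) // leq_addl.
  by apply.
- move=> [m xy]; apply/cvgr0Pnorm_lt => e e0; have [N [d [d0 hd]]] := dX_small W e0.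
  exists (m + N)%N => // n /= Nn; rewrite ger0_norm ?dX_ge0 //.
  apply: hd => i iN; rewrite !coord_iter_phi.
  have -> : n = ((n - (m + i)) + m + i)%N by rewrite -addnA subnK // (leq_trans _ Nn) // leq_add2l.
  rewrite iterD [iter (_ + _ + i) g (sol_coord y i)]iterD !iter_coord0.
  by rewrite iterD [iter (_ + m) g (sol_coord y 0)]iterD xy mdistxx.
Qed.

Lemma coord_iter_phi_eq m k i x y : iter m g (sol_coord x 0) = iter m g (sol_coord y 0) ->
  (m + i <= k)%N -> sol_coord (iter k phi x) i = sol_coord (iter k phi y) i.
Proof.
move=> xy mk; rewrite !coord_iter_phi -(subnK mk) addnA iterD [in RHS]iterD.
rewrite !iter_coord0.
by rewrite iterD [in RHS]iterD xy.
Qed.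

Lemma sim_s_germ x y : sim_s x y -> exists m, same_germ (iter m phi x) (iter m phi y).
Proof.
move=> /sim_sP[m xy]; exists (m + K)%N.
have c i : (i <= K)%N -> sol_coord (iter (m + K) phi x) i = sol_coord (iter (m + K) phi y) i.
  by move=> iK; apply: coord_iter_phi_eq xy _; rewrite leq_add2l.
split; first exact: c.
  by apply: covers_coordK; exact: c.
by apply: covers_coordK; apply/esym; exact: c.
Qed.

Section Sim0.
Variables (P : invariantSet W) (epsY : R).
Hypothesis heps : 0 < epsY < beta / 4.

Lemma XuP_near x y : XuP P x ->
  (forall n, mdist (sol_coord x n) (sol_coord y n) <= beta) -> XuP P y.
Proof.
move=> [p Pp xp] xy; exists p => //; apply: sim_u_trans xp.
by apply: near_pt_sim_u => n; rewrite mdistC.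
Qed.

Lemma XuP_near_pt e x y : e <= beta -> XuP P x -> near_pt e x y -> XuP P y.
Proof. by move=> eb Px xy; apply: XuP_near Px _ => n; exact: ltW (lt_le_trans (xy n) eb). Qed.

Lemma XuP_phi x : XuP P x -> XuP P (phi x).
Proof.
move=> [p Pp /sim_uP xp]; exists (phi p); first by rewrite -(inv_phi P); exists p.
apply/sim_uP => e e0; have [d d0 hd] := @wg_unif_continuous R W _ e0.
have [N hN] := xp _ d0; exists N => n /hN; rewrite !coord_phi; exact: hd.
Qed.

Lemma XuP_iter_phi k x : XuP P x -> XuP P (iter k phi x).
Proof. by move=> Px; elim: k => //= k; exact: XuP_phi. Qed.

(** From left to right, y itself belongs to U: the point of U above x_0 = y_0 is y, by injectivity
    of the zeroth coordinate near y. Equality of images then gives both inclusions of germs, with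
    lifts made small by [near_pt_of_coord0]. *)
Lemma sim0P x y : sim0 P epsY x y <-> [/\ XuP P x, XuP P y & same_germ x y].
Proof.
have b0 := betaP; have /andP[epsY0 epsYb] := heps.
split.
- move=> [Px Py xy [d [U [/andP[d0 dY] [_ oU] Uy UE]]]]; split => //.
  have eX : d <= beta / 2 by lra.
  have [d1 d10 hd1] := near_pt_Xu W d0.
  have Uyy : U y.
    have : (@pi0 R W @` Xu x d) (pi0 x) by exists x => //; apply: hd1; exact: near_ptxx.
    rewrite UE => -[u Uu ux]; rewrite -(@near_pt_inj R W u y) //; last exact: (etrans ux xy).
    move=> n; rewrite mdistC; have := Xu_near_pt (Uy _ Uu) n; lra.
  split => //.
  + move=> e e0; have [d2 d20 hd2] := near_pt_of_coord0 W e0.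
    exists (Num.min d1 d2); first by rewrite lt_min d10.
    move=> s xs; have : (@pi0 R W @` Xu x d) (pi0 s).
      by exists s => //; apply: hd1; apply: near_ptW xs; rewrite ge_min lexx.
    rewrite UE => -[u Uu us]; exists u => //; apply: hd2.
      move=> n; have := Xu_near_pt (Uy _ Uu) n; lra.
    move: us xy; rewrite /pi0 => -> <-; have := xs 0%N; rewrite lt_min => /andP[] //.
  + move=> e e0; have [d2 d20 hd2] := near_pt_of_coord0 W e0.
    have [r [r0 _ rU]] := oU _ Uyy; have [r1 r10 hr1] := near_pt_Xu W r0.
    exists (Num.min r1 d2); first by rewrite lt_min r10.
    move=> u yu; have : (@pi0 R W @` U) (pi0 u).
      by exists u => //; apply/rU/hr1; apply: near_ptW yu; rewrite ge_min lexx.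
    rewrite -UE => -[s xs su]; exists s => //; apply: hd2.
      move=> n; have := Xu_near_pt xs n; lra.
    move: su xy; rewrite /pi0 => -> ->; have := yu 0%N; rewrite lt_min => /andP[] //.
- move=> [Px Py [xy cxy cyx]]; split => //.
  have [e1 e10 he1] := cyx _ epsY0.
  have [e3 e30 he3] := near_pt_Xu W epsY0.
  (* Halved because openness of U goes from y to u and then from u to v. *)
  pose e2 := Num.min e1 e3 / 2.
  have e20 : 0 < e2 by rewrite divr_gt0 // lt_min e10.
  have e21 : e2 + e2 <= e1 by rewrite -splitr ge_min lexx.
  have e23 : e2 + e2 <= e3 by rewrite -splitr ge_min lexx orbT.
  have [eta eta0 heta] := near_pt_of_coord0 W e20.
  have [d1 d10 hd1] := cxy _ e20.
  have [d [d0 dd1 deta dY]] : exists d : R, [/\ 0 < d, d <= d1, d <= eta & d <= epsY / 2].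
    exists (Num.min d1 (Num.min eta (epsY / 2))).
    by rewrite !lt_min d10 eta0 !ge_min !lexx !orbT; split => //; lra.
  have dX2 : d <= epsX W by rewrite /epsX; lra.
  (* U is the part of the neighborhood of y lying above the image of [Xu x d]. It is open: a point v
     near u lifts to some t near x, and t is near s because t_0 is near s_0, so t stays in
     [Xu x d]. *)
  exists d, [set u | Xu y epsY u /\ exists2 s, Xu x d s & sol_coord s 0 = sol_coord u 0].
  split; first by rewrite d0; lra.
  + split.
      by move=> u [/Xu_near_pt yu _]; apply: XuP_near_pt Py yu; lra.
    move=> u [yu [s xs su]].
    have yu2 : near_pt e2 y u.
      apply: heta; first by move=> n; have := Xu_near_pt yu n; lra.
      by rewrite -su -xy; have := Xu_near_pt xs 0%N; lra.
    have [r r0 hr] := Xu_open dX2 xs.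
    have [eta' eta'0 heta'] := near_pt_of_coord0 W r0.
    have [rho [rho0 r1 r2 r3]] : exists d : R, [/\ 0 < d, d <= e2, d <= eta' & d <= epsX W].
      exists (Num.min e2 (Num.min eta' (epsX W))).
      by rewrite !lt_min e20 eta'0 !ge_min !lexx !orbT; split => //; rewrite /epsX divr_gt0.
    exists rho; split => // v /Xu_near_pt uv.
    have yv : near_pt (e2 + e2) y v by apply: near_pt_trans yu2 (near_ptW r1 uv).
    split; first by apply: he3; exact: near_ptW yv.
    have [t xt tv] := he1 v (near_ptW e21 yv).
    exists t => //; apply: hr; apply: heta'.
      move=> n; have := near_pt_trans (near_ptC (Xu_near_pt xs)) xt n; lra.
    by rewrite tv su; exact: lt_le_trans (uv 0%N) r2.
  + by move=> u [].
  + apply/seteqP; split => [w [s xs <-]|w [s [_ [t xt ts]] <-]]; last by exists t.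
    have [u yu us] := hd1 s (near_ptW dd1 (Xu_near_pt xs)).
    exists u => //; split; last by exists s.
    by apply: he3; apply: near_ptW yu; lra.
Qed.

Lemma GkP k x y : Gk P epsY k (x, y) <->
  [/\ XuP P x, XuP P y & same_germ (iter k phi x) (iter k phi y)].
Proof.
split; first by move=> [/= ? ? /sim0P[]].
by move=> [Px Py xy]; split => //=; apply/sim0P; split => //; exact: XuP_iter_phi.
Qed.

Lemma Gk_coord k x y : Gk P epsY k (x, y) ->
  iter k g (sol_coord x 0) = iter k g (sol_coord y 0).
Proof. by move=> /GkP[_ _ []]; rewrite !coord_iter_phi. Qed.

Lemma bigcup_Gk : \bigcup_k Gk P epsY k = Gs P.
Proof.
apply/seteqP; split=> [[x y] [k _ xy]|[x y] [/= Px Py /sim_s_germ[m xy]]].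
  by have /GkP[Px Py _] := xy; split => //=; apply/sim_sP; exists k; exact: Gk_coord xy.
by exists m => //; apply/GkP.
Qed.

End Sim0.
End Germs.

(** * The topology of the stable groupoid *)

Section EtaleTopology.
Variables (R : realType) (W : wielerData R) (P : invariantSet W).
Local Notation Y := (wY W).
Local Notation X := (solenoid W).
Local Notation g := (@wg R W).
Local Notation K := (wK W).
Local Notation beta := (wbeta W).
Local Notation phi := (@phi R W).
Local Notation phi_inv := (@phi_inv R W).
Local Notation G := (GsT P).
Local Notation rng p := (gs_val p).1.
Local Notation src p := (gs_val p).2.
Implicit Types (x y z u v a b s t : X) (p q : G).

Lemma gs_eq p q : rng p = rng q -> src p = src q -> p = q.
Proof.
case: p q => [[x y] Gp] [[x' y'] Gq] /= xx yy; move: Gp Gq; rewrite xx yy => Gp Gq.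
by congr GsElt; exact: Prop_irrelevance.
Qed.

Lemma near_pt_iter_inj m : exists2 e : R, 0 < e & forall x a b,
  near_pt e x a -> near_pt e x b ->
  iter m g (sol_coord a 0) = iter m g (sol_coord b 0) -> a = b.
Proof.
have b2 : 0 < beta / 2 by rewrite divr_gt0 ?betaP.
have [e e0 he] := near_pt_iter_phi W m b2; exists e => // x a b xa xb ab.
apply: (can_inj (iter_phiK (W := W) m)); apply: near_pt_inj.
  by apply: near_pt_le_beta (lexx _) (he m _ _ (leqnn _) xa) (he m _ _ (leqnn _) xb).
by rewrite !coord_iter_phi.
Qed.

Definition germ_at m p := same_germ (iter m phi (rng p)) (iter m phi (src p)).

Lemma germ_at_coord m p : germ_at m p ->
  iter m g (sol_coord (rng p) 0) = iter m g (sol_coord (src p) 0).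
Proof. by move=> []; rewrite !coord_iter_phi. Qed.

Lemma germ_at_leq m n p : (m <= n)%N -> germ_at m p -> germ_at n p.
Proof.
move=> mn; rewrite -(subnK mn); elim: (n - m)%N => // k IH mp; rewrite addSn /germ_at !iterS.
exact/same_germ_phi/IH.
Qed.

Lemma germ_at_exists p : exists m, germ_at m p.
Proof. by have [_ _ /sim_s_germ] := gs_valP p. Qed.

(** For p of level m ([germ_at m p]) and small e, the equation determines the range from the source,
    so that the box is a piece of the graph of h. *)
Definition gs_box m (e : R) p : set G := [set q |
  [/\ near_pt e (rng p) (rng q), near_pt e (src p) (src q) &
      iter m g (sol_coord (rng q) 0) = iter m g (sol_coord (src q) 0)]].

Lemma gs_boxxx m e p : 0 < e -> germ_at m p -> gs_box m e p p.
Proof. by move=> e0 /germ_at_coord mp; split => //; exact: near_ptxx. Qed.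

Lemma gs_boxW m e e' p : e <= e' -> gs_box m e p `<=` gs_box m e' p.
Proof. by move=> ee q [h1 h2 h3]; split => //; [exact: near_ptW h1|exact: near_ptW h2]. Qed.

Lemma gs_box_trans m e e' p q : gs_box m e p q -> gs_box m e' q `<=` gs_box m (e + e') p.
Proof.
by move=> [h1 h2 _] r [h3 h4 h5]; split => //; [exact: near_pt_trans h3|exact: near_pt_trans h4].
Qed.

Lemma germ_at_open m p : germ_at m p -> exists2 e : R, 0 < e & gs_box m e p `<=` germ_at m.
Proof.
move=> /same_germ_open[e e0 he]; have [d d0 hd] := near_pt_iter_phi W m e0.
exists d => // q [h1 h2 h3]; apply: he; [exact: hd|exact: hd|].
by rewrite !coord_iter_phi.
Qed.

(** Existence of the local homeomorphism h: lift phi^m b to a point near phi^m x and pull it back by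
    phi^(-m). *)
Lemma germ_at_section m x y : same_germ (iter m phi x) (iter m phi y) ->
  forall e : R, 0 < e -> exists2 d : R, 0 < d & forall b, near_pt d y b ->
    exists2 a, near_pt e x a & iter m g (sol_coord a 0) = iter m g (sol_coord b 0).
Proof.
move=> [_ _ c] e e0; have [d d0 hd] := c _ e0; have [d' d'0 hd'] := near_pt_iter_phi W m d0.
exists d' => // b /(hd' m _ _ (leqnn _)) /hd[t xt tb].
exists (iter m phi_inv t).
  by have := near_pt_phi_inv m xt; rewrite iter_phiK.
by rewrite -!coord_iter_phi iter_phi_invK.
Qed.

Lemma epsX_gt0 : 0 < epsX W. Proof. by rewrite divr_gt0 ?betaP. Qed.

Lemma bracket_unique x y w w' : Xs x (epsX W) w -> Xu y (epsX W) w ->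
  Xs x (epsX W) w' -> Xu y (epsX W) w' -> w = w'.
Proof.
move=> [xw _] /Xu_near_pt yw [xw' _] /Xu_near_pt yw'; apply: near_pt_inj.
  exact: near_pt_le_beta yw yw'.
by rewrite xw ?xw' // wK_ge1.
Qed.

(** Removes the existential radius: by uniqueness, a bracket at any radius is the bracket at the
    maximal one. *)
Lemma is_bracketP x y w : is_bracket x y w <-> Xs x (epsX W) w /\ Xu y (epsX W) w.
Proof.
split.
- move=> [e [e0 eX E]]; have : (Xs x e `&` Xu y e) w by rewrite E.
  move=> [[h1 h2] [h3 h4]]; split; split => //; try exact: lt_le_trans eX.
  by move=> n; exact: lt_le_trans eX.
- move=> [xw yw]; exists (epsX W); split => //; first exact: epsX_gt0.
  by apply/seteqP; split => [w' [xw' yw']|_ ->//]; exact: bracket_unique xw' yw' xw yw.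
Qed.

Lemma gs_nbhs_of_box m e p U : germ_at m p -> 0 < e -> gs_box m e p `<=` U -> gs_nbhs p U.
Proof.
move=> mp e0 boxU.
have eX2 : 0 < epsX W / 2 by rewrite divr_gt0 ?epsX_gt0.
have eX21 : epsX W / 2 <= epsX W by have := epsX_gt0; lra.
have [N [eta [eta0 heta]]] := dX_small W eX2.
(* After m steps the zeroth coordinates agree; N + K further steps make the coordinates up to N + K
   agree, K of them for the condition in [Xs] and N for the bound on [dX]. *)
pose k := (m + (N + K))%N.
have [e1 e10 he1] := near_pt_Xu W epsX_gt0.
have [e1' e1'0 he1'] := near_pt_iter_phi W k e10.
have [e2 e20 he2] := near_pt_Xu W eX2.
have [e2' e2'0 he2'] := near_pt_iter_phi W k e20.
have ee1 : 0 < Num.min e e1' by rewrite lt_min e0.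
have [d1 d10 hd1] := germ_at_section mp ee1.
have [d [d0 dd1 de dd2 dX]] : exists d : R, [/\ 0 < d, d <= d1, d <= e, d <= e2' & d <= epsX W].
  exists (Num.min d1 (Num.min e (Num.min e2' (epsX W)))).
  by rewrite !lt_min d10 e0 e2'0 !ge_min !lexx !orbT; split => //; exact: epsX_gt0.
have stable a b : iter m g (sol_coord a 0) = iter m g (sol_coord b 0) ->
    Xs (iter k phi b) (epsX W / 2) (iter k phi a).
  move=> ab; have c i : (i <= N + K)%N ->
      sol_coord (iter k phi a) i = sol_coord (iter k phi b) i.
    by move=> iN; apply: coord_iter_phi_eq ab _; rewrite leq_add2l.
  split; first by move=> i iK; apply: c; rewrite ltnW // ltn_addl.
  by apply: heta => i iN; rewrite c ?mdistxx // (leq_trans iN) // leq_addr.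
have bracket b : near_pt d (src p) b -> exists a, [/\ near_pt e (rng p) a,
    iter m g (sol_coord a 0) = iter m g (sol_coord b 0) &
    is_bracket (iter k phi b) (iter k phi (rng p)) (iter k phi a)].
  move=> pb; have [a pa ab] := hd1 b (near_ptW dd1 pb).
  exists a; split => //.
    by apply: near_ptW pa; rewrite ge_min lexx.
  apply/is_bracketP; split.
    by have [h1 h2] := stable _ _ ab; split => //; exact: lt_le_trans eX21.
  by apply/he1/he1' => //; apply: near_ptW pa; rewrite ge_min lexx orbT.
apply: (@filterS _ (gs_nbhs p) _ (gs_basic (gs_val p) k d)); last first.
  apply: sub_gen_smallest; exists k, d; split => //.
  rewrite /gs_admissible; case E : (gs_val p) => [x y]; split => //.
  - by apply: stable; have := germ_at_coord mp; rewrite E.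
  - move=> _ [b /Xu_near_pt yb <-]; apply/he2/he2' => //.
    exact: near_ptW yb.
  - move=> b /Xu_near_pt yb; have [|a [_ _ ?]] := bracket b; first by rewrite E.
    by exists (iter k phi a); rewrite (_ : x = rng p) // E.
move=> q [/Xu_near_pt qs qr]; apply: boxU.
have [a [pa ab /is_bracketP[a1 a2]]] := bracket _ qs.
have /is_bracketP[b1 b2] := qr.
have /(can_inj (iter_phiK (W := W) k)) qa := bracket_unique a1 a2 b1 b2.
by split; rewrite -?qa //; exact: near_ptW qs.
Qed.

(** By minimality of the generated filter, it suffices to put a box inside each basic set, whatever
    its k. *)
Lemma gs_box_of_nbhs m p U : germ_at m p -> gs_nbhs p U ->
  exists2 e : R, 0 < e & gs_box m e p `<=` U.
Proof.
move=> mp; pose F : set_system G := [set U | exists2 e : R, 0 < e & gs_box m e p `<=` U].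
have FF : Filter F.
  split; first by exists 1.
    move=> A B [e e0 eA] [e' e'0 e'B]; exists (Num.min e e'); first by rewrite lt_min e0.
    by move=> q qb; split; [apply: eA|apply: e'B]; apply: gs_boxW qb; rewrite ge_min lexx ?orbT.
  by move=> A B AB [e e0 eA]; exists e => // q /eA/AB.
apply: (@smallest_sub _ _ _ F) => // _ [k [d [adm ->]]].
move: adm; rewrite /gs_admissible /gs_basic; have := germ_at_coord mp; rewrite /F /gs_box.
move: mp; rewrite /germ_at; case: (gs_val p) => [x y] /= mp xym [[xyk _] d0 dX _ br].
have K0 := wK_ge1 W.
(* The box equates range and source after m steps, the bracket after k steps; at m + k both apply,
   and local injectivity identifies the range of q with the pulled-back bracket. *)
have [e1 e10 inj1] := near_pt_iter_inj (m + k).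
have [d1 d10 hd1] := near_pt_of_coord0 W e10.
have [d2 d20 hd2] := near_pt_iter_phi W k d10.
have [d3 d30 hd3] := near_pt_Xu W d0.
exists (Num.min e1 (Num.min d2 d3)); first by rewrite !lt_min e10 d20.
move=> q [qr qs qm]; have yq : Xu y d (src q).
  by apply: hd3; apply: near_ptW qs; rewrite !ge_min lexx !orbT.
split => //; have [w /[dup] brw /is_bracketP[[w1 _] w2]] := br _ yq.
suff -> : rng q = iter k phi_inv w by rewrite iter_phi_invK.
have xw : near_pt e1 (iter k phi x) w.
  apply: hd1; first by move=> n; have := Xu_near_pt w2 n; rewrite /epsX; have := betaP W; lra.
  rewrite xyk // w1 //; apply: hd2 => //.
  by apply: near_ptW qs; rewrite !ge_min lexx !orbT.
apply: (inj1 x).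
- by apply: near_ptW qr; rewrite !ge_min lexx.
- by have := near_pt_phi_inv k xw; rewrite iter_phiK.
- rewrite addnC iterD qm -iterD addnC iterD.
  rewrite [RHS]iterD; congr (iter m g _).
  by rewrite -!coord_iter_phi iter_phi_invK w1.
Qed.

Lemma nbhs_box m p U : germ_at m p -> nbhs p U <-> exists2 e : R, 0 < e & gs_box m e p `<=` U.
Proof.
move=> mp; split.
  by move=> [B [oB Bp BU]]; have [e e0 h] := gs_box_of_nbhs mp (oB p Bp); exists e => // q /h/BU.
(* The interior of U. It is open because a half-size box around a point of a half-size box stays in
   the full one, and a small box consists of points of the same level. *)
move=> [e e0 pU]; exists [set q | gs_nbhs q U]; split.
- move=> q /= qU; have [n nq] := germ_at_exists q.
  have [e1 e10 h1] := gs_box_of_nbhs nq qU; have [e2 e20 h2] := germ_at_open nq.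
  apply: (gs_nbhs_of_box (e := Num.min (e1 / 2) e2) nq).
    by rewrite lt_min e20 divr_gt0.
  move=> r rq /=; apply: (gs_nbhs_of_box (m := n) (e := e1 / 2)).
  + by apply: h2; apply: gs_boxW rq; rewrite ge_min lexx orbT.
  + by rewrite divr_gt0.
  + move=> s rs; apply: h1; rewrite [e1]splitr; apply: gs_box_trans rs.
    by apply: gs_boxW rq; rewrite ge_min lexx.
- exact: gs_nbhs_of_box pU.
- move=> q /= qU; have [n nq] := germ_at_exists q.
  by have [e1 e10] := gs_box_of_nbhs nq qU; apply; exact: gs_boxxx.
Qed.

Lemma open_germ_at m : open (germ_at m : set G).
Proof.
rewrite openE => p mp; apply/(nbhs_box _ mp); exact: germ_at_open.
Qed.

End EtaleTopology.

(** * Multiplication, local sections of the source map, and the shift *)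

Section GroupoidOperations.
Variables (R : realType) (W : wielerData R) (P : invariantSet W).
Local Notation Y := (wY W).
Local Notation X := (solenoid W).
Local Notation g := (@wg R W).
Local Notation beta := (wbeta W).
Local Notation phi := (@phi R W).
Local Notation phi_inv := (@phi_inv R W).
Local Notation G := (GsT P).
Local Notation rng p := (gs_val p).1.
Local Notation src p := (gs_val p).2.
Implicit Types (x y z u v : X) (p q a b : G).

Lemma near_pt_rng p (e : R) : 0 < e -> \forall q \near p, near_pt e (rng p) (rng q).
Proof.
move=> e0; have [m mp] := germ_at_exists p.
by apply/(nbhs_box _ mp); exists e => // q [].
Qed.

Lemma near_pt_src p (e : R) : 0 < e -> \forall q \near p, near_pt e (src p) (src q).
Proof.
move=> e0; have [m mp] := germ_at_exists p.
by apply/(nbhs_box _ mp); exists e => // q [].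
Qed.

Lemma solenoid_separated x y : x <> y -> exists2 e : R, 0 < e &
  forall x' y', near_pt e x x' -> near_pt e y y' -> x' <> y'.
Proof.
move=> xy; have [n /eqP xyn] : exists n, sol_coord x n <> sol_coord y n.
  by apply: contrapT => /forallNP h; apply/xy/solenoid_eq => n; apply: contrapT; exact: h.
exists (mdist (sol_coord x n) (sol_coord y n) / 2); first by rewrite divr_gt0 // mdist_gt0.
move=> x' y' /(_ n) h1 /(_ n) h2 E; move: h1 h2; rewrite E => h1 h2.
have := mdist_triangle (sol_coord y' n) (sol_coord x n) (sol_coord y n).
by rewrite (mdistC (sol_coord y' n)); lra.
Qed.

Lemma rng_separated a b : rng a <> rng b ->
  exists A B : set G, [/\ nbhs a A, nbhs b B & forall a' b', A a' -> B b' -> rng a' <> rng b'].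
Proof.
move=> /solenoid_separated[e e0 he].
exists [set a' | near_pt e (rng a) (rng a')], [set b' | near_pt e (rng b) (rng b')].
by split; [exact: near_pt_rng|exact: near_pt_rng|move=> a' b'; exact: he].
Qed.

Lemma src_separated a b : src a <> src b ->
  exists A B : set G, [/\ nbhs a A, nbhs b B & forall a' b', A a' -> B b' -> src a' <> src b'].
Proof.
move=> /solenoid_separated[e e0 he].
exists [set a' | near_pt e (src a) (src a')], [set b' | near_pt e (src b) (src b')].
by split; [exact: near_pt_src|exact: near_pt_src|move=> a' b'; exact: he].
Qed.

Lemma src_rng_separated a b : src a <> rng b ->
  exists A B : set G, [/\ nbhs a A, nbhs b B & forall a' b', A a' -> B b' -> src a' <> rng b'].
Proof.
move=> /solenoid_separated[e e0 he].
exists [set a' | near_pt e (src a) (src a')], [set b' | near_pt e (rng b) (rng b')].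
by split; [exact: near_pt_src|exact: near_pt_rng|move=> a' b'; exact: he].
Qed.

Lemma gs_separated p q : p <> q ->
  exists A B : set G, [/\ nbhs p A, nbhs q B & A `&` B = set0].
Proof.
move=> pq; have [rpq|rpq] := pselect (rng p = rng q).
  have /src_separated[A [B [pA qB AB]]] : src p <> src q by move=> spq; apply/pq/gs_eq.
  by exists A, B; split => //; apply/seteqP; split => // r [/AB h /h].
have /rng_separated[A [B [pA qB AB]]] := rpq.
by exists A, B; split => //; apply/seteqP; split => // r [/AB h /h].
Qed.

Lemma gs_hausdorff : hausdorff_space G.
Proof.
move=> p q pq; apply: contrapT => /gs_separated[A [B [pA qB AB]]].
by have [r] := pq A B pA qB; rewrite AB.
Qed.

Lemma gs_inv_continuous : continuous (@gs_inv R W P).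
Proof.
move=> p U; have [m mp] := germ_at_exists p.
have mp' : germ_at m (gs_inv p) by exact: same_germ_sym.
move=> /(nbhs_box _ mp')[e e0 eU]; apply/(nbhs_box _ mp); exists e => // q [h1 h2 h3].
by apply: eU; split.
Qed.

Lemma gs_comp_subproof a b : src a = rng b -> Gs P (rng a, src b).
Proof.
move=> ab; have [ra _ /sim_sP[m am]] := gs_valP a; have [_ sb /sim_sP[n bn]] := gs_valP b.
split => //; apply/sim_sP; exists (n + m)%N.
by rewrite iterD am -iterD ab addnC iterD bn -iterD addnC.
Qed.

(* Junk value [a] when [a] and [b] are not composable. *)
Definition gs_mul a b : G :=
  if pselect (src a = rng b) is left ab then GsElt (gs_comp_subproof ab) else a.

Lemma gs_mul_rng a b : rng (gs_mul a b) = rng a.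
Proof. by rewrite /gs_mul; case: pselect. Qed.

Lemma gs_mul_src a b : src a = rng b -> src (gs_mul a b) = src b.
Proof. by rewrite /gs_mul; case: pselect. Qed.

Lemma gs_mulP a b p : gs_is_mul a b p <-> src a = rng b /\ p = gs_mul a b.
Proof.
split.
  by move=> [ab ap bp]; split => //; apply: gs_eq; rewrite ?gs_mul_rng ?gs_mul_src.
by move=> [ab ->]; split; rewrite ?gs_mul_rng ?gs_mul_src.
Qed.

(** Both factors are raised to the level m + n, which is then also a level of the product; the
    equations of the two boxes chain through the common middle point. *)
Lemma gs_mul_cvg (T : Type) (F : set_system T) (FF : Filter F) (al be : T -> G) a b :
  src a = rng b -> (\forall t \near F, src (al t) = rng (be t)) ->
  al @ F --> a -> be @ F --> b -> (fun t => gs_mul (al t) (be t)) @ F --> gs_mul a b.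
Proof.
move=> ab near_ab ala beb U.
have [m am] := germ_at_exists a; have [n bn] := germ_at_exists b.
have {}am : germ_at (m + n) a by apply: germ_at_leq am; exact: leq_addr.
have {}bn : germ_at (m + n) b by apply: germ_at_leq bn; exact: leq_addl.
have cn : germ_at (m + n) (gs_mul a b).
  rewrite /germ_at gs_mul_rng gs_mul_src //; apply: same_germ_trans am _.
  by rewrite ab.
move=> /(nbhs_box _ cn)[e e0 eU].
have hA : nbhs a (gs_box (m + n) e a) by apply/(nbhs_box _ am); exists e.
have hB : nbhs b (gs_box (m + n) e b) by apply/(nbhs_box _ bn); exists e.
have hA' : F (al @^-1` gs_box (m + n) e a) := ala _ hA.
have hB' : F (be @^-1` gs_box (m + n) e b) := beb _ hB.
apply: filterS (filterI near_ab (filterI hA' hB')) => t [abt [[h1 _ h2] [_ h3 h4]]].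
apply: eU.
split; rewrite ?gs_mul_rng ?gs_mul_src //.
by rewrite h2 abt h4.
Qed.

Lemma src_injective b : exists2 V : set G, nbhs b V &
  forall b1 b2, V b1 -> V b2 -> src b1 = src b2 -> b1 = b2.
Proof.
have [m bm] := germ_at_exists b; have [e e0 he] := near_pt_iter_inj W m.
exists (gs_box m e b); first by apply/(nbhs_box _ bm); exists e.
move=> b1 b2 [h1 _ h2] [h3 _ h4] s12; apply: gs_eq => //; apply: he h1 h3 _.
by rewrite h2 h4 s12.
Qed.

(** Only the sources of b and p agree: in a convolution, one base point p is used for all elements b
    of its source fibre. *)
Lemma src_open b p V : src b = src p -> nbhs b V ->
  \forall q \near p, exists2 b', V b' & src b' = src q.
Proof.
move=> bp; have [m bm] := germ_at_exists b => /(nbhs_box _ bm)[e e0 eV].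
have e1 : 0 < Num.min e beta by rewrite lt_min e0 betaP.
have [d d0 hd] := germ_at_section bm e1.
have de : 0 < Num.min d e by rewrite lt_min d0.
have := near_pt_src p de; apply: filterS => q; rewrite -bp => pq.
have [|x bx xq] := hd (src q); first by apply: near_ptW pq; rewrite ge_min lexx.
have [rb _ _] := gs_valP b; have [_ sq _] := gs_valP q.
have Gx : Gs P (x, src q).
  split => //; last by apply/sim_sP; exists m.
  by apply: XuP_near_pt (lexx _) rb _; apply: near_ptW bx; rewrite ge_min lexx orbT.
exists (GsElt Gx) => //; apply: eV; split => //=.
  by apply: near_ptW bx; rewrite ge_min lexx.
by apply: near_ptW pq; rewrite ge_min lexx orbT.
Qed.

Lemma gs_phi_subproof p : Gs P (phi (rng p), phi (src p)).
Proof.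
have [rp sp /sim_sP[m mp]] := gs_valP p; split; [exact: XuP_phi|exact: XuP_phi|].
by apply/sim_sP; exists m; rewrite !coord_phi -!iterSr /= mp.
Qed.

Definition gs_phi p : G := GsElt (gs_phi_subproof p).

Lemma gs_phiK : cancel gs_phi (@gs_phi_inv R W P).
Proof. by move=> p; apply: gs_eq; rewrite /= phiK. Qed.

Lemma gs_phi_invK : cancel (@gs_phi_inv R W P) gs_phi.
Proof. by move=> p; apply: gs_eq; rewrite /= phi_invK. Qed.

Lemma germ_at_phi m p : germ_at m (gs_phi p) <-> germ_at m.+1 p.
Proof. by rewrite /germ_at !iterSr. Qed.

Lemma germ_at_iter_phi n m p : germ_at m (iter n gs_phi p) <-> germ_at (m + n) p.
Proof.
elim: n m => [|n IH] m; first by rewrite addn0.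
by rewrite iterS germ_at_phi IH addSnnS.
Qed.

Lemma gs_phi_continuous : continuous gs_phi.
Proof.
move=> p U; have [m mp] := germ_at_exists p.
have mp' : germ_at m (gs_phi p) by apply/germ_at_phi; exact: germ_at_leq mp.
move=> /(nbhs_box _ mp')[e e0 eU]; have [d d0 hd] := near_pt_iter_phi W 1 e0.
apply/(nbhs_box _ mp); exists d => // q [h1 h2 h3].
apply: eU; split => /=; [exact: (hd 1%N)|exact: (hd 1%N)|].
by rewrite -!iterSr /= h3.
Qed.

Lemma gs_phi_inv_continuous : continuous (@gs_phi_inv R W P).
Proof.
move=> p U; have [m mp] := germ_at_exists p.
have mp' : germ_at m.+1 (gs_phi_inv p) by apply/germ_at_phi; rewrite gs_phi_invK.
move=> /(nbhs_box _ mp')[e e0 eU].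
apply/(nbhs_box _ mp); exists e => // q [h1 h2 h3].
apply: eU; split => /=; [exact: (near_pt_phi_inv 1)|exact: (near_pt_phi_inv 1)|].
by rewrite -!iterS !iterSr !solenoidP.
Qed.

Lemma gs_is_mul_phi_inv a b p : gs_is_mul a b p ->
  gs_is_mul (gs_phi_inv a) (gs_phi_inv b) (gs_phi_inv p).
Proof. by move=> [h1 h2 h3]; split; rewrite /= ?h1 ?h2 ?h3. Qed.

Lemma gs_is_mul_phi a b p : gs_is_mul a b p -> gs_is_mul (gs_phi a) (gs_phi b) (gs_phi p).
Proof. by move=> [h1 h2 h3]; split; rewrite /= ?h1 ?h2 ?h3. Qed.

Lemma GkTE (epsY : R) k : 0 < epsY < beta / 4 -> GkT P epsY k = germ_at k.
Proof.
move=> he; apply/seteqP; split => p; rewrite /GkT /= /germ_at.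
  by rewrite (surjective_pairing (gs_val p)) => /(GkP _ he)[].
move=> h; rewrite (surjective_pairing (gs_val p)); apply/(GkP _ he).
by have [? ? _] := gs_valP p.
Qed.

End GroupoidOperations.

(** * Convolution on the stable groupoid *)

Section CompactSupport.
Variables (R : realType) (W : wielerData R) (P : invariantSet W).
Local Notation G := (GsT P).
Local Notation C := (Cx R).
Local Notation rng p := (gs_val p).1.
Local Notation src p := (gs_val p).2.
Implicit Types (p q a b : G) (A : set G) (f h : G -> C).

(** Extension by zero stays continuous: off A the function vanishes on the complement of its compact
    support, which is open because the groupoid is Hausdorff. *)
Lemma CcP A f : open A -> Cc A f <-> continuous f /\
  exists2 D : set G, compact D /\ D `<=` A & forall p, ~ D p -> f p = 0.
Proof.
move=> oA; rewrite /Cc /= continuous_open_subspace //; split.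
- move=> [f0 cf [D [cD DA] fD]]; split; last by exists D.
  move=> p; have [Ap|nAp] := pselect (A p); first by apply: cf; rewrite inE.
  have nDp : (~` D) p by move/DA.
  have oD : nbhs p (~` D).
    apply: open_nbhs_nbhs; split => //.
    exact/closed_openC/(compact_closed (@gs_hausdorff R W P)).
  move=> U /nbhs_singleton; rewrite (f0 _ nAp) => U0.
  by apply: filterS oD => q /fD; rewrite /= => ->.
- move=> [cf [D [cD DA] fD]]; split; last by exists D.
    by move=> p nA; apply: fD => /DA.
  by move=> p _; exact: cf.
Qed.

Lemma Cc_sub A B f : open A -> open B -> A `<=` B -> Cc A f -> Cc B f.
Proof.
move=> oA oB AB /(CcP _ oA)[cf [D [cD DA] fD]]; apply/(CcP _ oB); split => //.
by exists D => //; split => // p /DA/AB.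
Qed.

Lemma Cc_lin A (c : C) f h : open A -> Cc A f -> Cc A h -> Cc A (fun p => c * f p + h p).
Proof.
move=> oA /(CcP _ oA)[cf [D [cD DA] fD]] /(CcP _ oA)[ch [E [cE EA] hE]]; apply/(CcP _ oA); split.
  by move=> p; apply: cvgD (ch p); apply: cvgM (cvg_cst c) (cf p).
exists (D `|` E); first by split; [exact: compactU|move=> p [/DA|/EA]].
by move=> p /not_orP[/fD -> /hE ->]; rewrite mulr0 addr0.
Qed.

Lemma Cc_comp (th th' : G -> G) A f : open A -> continuous th -> continuous th' ->
  cancel th th' -> cancel th' th -> Cc A f -> Cc (th @^-1` A) (f \o th).
Proof.
move=> oA cth cth' thK thK' /(CcP _ oA)[cf [D [cD DA] fD]].
have oA' : open (th @^-1` A) by apply: open_comp oA => p _; exact: cth.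
apply/(CcP _ oA'); split; first by move=> p; apply: continuous_comp; [exact: cth|exact: cf].
exists (th' @` D); last first.
  by move=> p nD; apply: fD => Dp; apply: nD; exists (th p) => //; rewrite thK.
split; last by move=> _ [p Dp <-]; rewrite /= thK'; exact: DA.
by apply: continuous_compact cD; exact: continuous_subspaceT.
Qed.

Lemma Cx_conj_continuous : continuous (fun z : C => z^*).
Proof.
move=> z.
apply: (iffRL (@cvgrPdist_lt _ C _ (nbhs z) (nbhs_filter z) (fun w => w^*) (z^*))) => e e0.
have := iffLR (@cvgrPdist_lt _ C _ (nbhs z) (nbhs_filter z) id z) (@cvg_id _ (nbhs z)) e e0.
by apply: filterS => w; rewrite -rmorphB norm_conjC.
Qed.

Lemma Cc_invol A f : open A -> (forall p, A p -> A (gs_inv p)) -> Cc A f -> Cc A (invol f).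
Proof.
have invK : involutive (@gs_inv R W P) by move=> p; apply: gs_eq.
move=> oA Ainv /(Cc_comp oA (@gs_inv_continuous R W P) (@gs_inv_continuous R W P) invK invK).
have -> : (@gs_inv R W P) @^-1` A = A.
  by apply/seteqP; split => p /Ainv //=; rewrite invK.
move=> /(CcP _ oA)[cf [D DA fD]]; apply/(CcP _ oA); split; last first.
  by exists D => // p /fD /= fp; rewrite /invol -[f _]/((f \o @gs_inv R W P) p) /= fp conjC0.
move=> p; apply: (@continuous_comp _ _ _ (f \o @gs_inv R W P)); first exact: cf.
exact: Cx_conj_continuous.
Qed.

Lemma convolE f h p :
  convol f h p = \sum_(b \in [set b : G | src b = src p]) (f (gs_mul p (gs_inv b)) * h b).
Proof.
rewrite /convol (reindex_fsbig (fun b => (gs_mul p (gs_inv b), b)) [set b | src b = src p]) //.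
split.
- move=> b /= bp; apply/gs_mulP; rewrite gs_mul_src //; split => //.
  by apply: gs_eq; rewrite ?gs_mul_rng // ?gs_mul_src //= gs_mul_src.
- by move=> b b' _ _ [].
- move=> [a b] /= [h1 h2 h3]; exists b => //=; congr pair.
  by apply: gs_eq; rewrite ?gs_mul_rng ?gs_mul_src.
Qed.

Lemma near_all (T : Type) (F : set_system T) (FF : Filter F) (I : eqType)
    (l : seq I) (Q : I -> T -> Prop) :
  (forall i, i \in l -> \forall t \near F, Q i t) ->
  \forall t \near F, forall i, i \in l -> Q i t.
Proof.
elim: l => [|i l IH] h; first exact: nearW.
have h1 := h i (mem_head _ _).
have h2 : \forall t \near F, forall j, j \in l -> Q j t.
  by apply: IH => j jl; apply: h; rewrite inE jl orbT.
by apply: filterS2 h1 h2 => t hi hl j; rewrite inE => /orP[/eqP->//|/hl].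
Qed.

(** Every point of D has a neighborhood meeting the fibre in at most one point, by local injectivity
    of the source map. *)
Lemma src_fiber_finite (D : set G) p0 : compact D -> finite_set [set b | D b /\ src b = src p0].
Proof.
move=> /compact_near_coveringP cD.
(* The filter of ever larger finite lists. *)
pose FL : set_system (seq G) :=
  filter_from setT (fun l0 : seq G => [set l : seq G | {subset l0 <= l}]).
have FF : Filter FL.
  apply: filter_from_filter; first by exists [::].
  move=> l l' _ _; exists (l ++ l') => // l'' /= h.
  by split => b bl; apply: h; rewrite mem_cat bl ?orbT.
have [|l0 _ hl0] := cD _ FL (fun l b => src b = src p0 -> b \in l) FF.
  move=> b _; have [bp|bp] := pselect (src b = src p0).
    have [V bV injV] := src_injective b.
    exists (V, [set l : seq G | (b : G) \in l]) => /=.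
      by split => //; exists [:: (b : G)] => // l; apply; rewrite inE.
    move=> [b' l] /= [Vb' bl] b'p; rewrite (injV b' b) // ?b'p //; exact: nbhs_singleton.
  have [A [B [bA pB AB]]] := src_separated bp.
  exists (A, setT); first by split => //; exact: filterT.
  by move=> [b' l] /= [Ab' _] /(AB _ _ Ab' (nbhs_singleton pB)).
apply: (sub_finite_set (B := [set` l0])); last exact: finite_seq.
by move=> b [Db bp]; apply: (hl0 l0) => //=.
Qed.

(* Near p0, the elements of D with the source of p lie on the local sections of
   the source map through the finitely many elements of D above the source of
   p0, so that the convolution is a finite sum of continuous functions. *)
Lemma convol_continuous f h (D : set G) : continuous f -> continuous h ->
  compact D -> (forall b, ~ D b -> h b = 0) -> continuous (convol f h).
Proof.
move=> cf ch cD hD p0.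
have nearS (Q Q' : G -> Prop) : (forall p, Q p -> Q' p) ->
    (\forall p \near p0, Q p) -> \forall p \near p0, Q' p by exact: filterS.
have nearI (Q Q' : G -> Prop) : (\forall p \near p0, Q p) ->
    (\forall p \near p0, Q' p) -> \forall p \near p0, Q p /\ Q' p by exact: filterI.
have FN : Filter (nbhs (p0 : G)) by exact: nbhs_filter.
have /choice[V hV] (b : G) : exists V : set G, nbhs b V /\
    forall b1 b2, V b1 -> V b2 -> src b1 = src b2 -> b1 = b2.
  by have [V ? ?] := src_injective b; exists V.
have Vb b : V b b by exact: nbhs_singleton (hV b).1.
(* The local section of the source map through b, with default value b where [V b] has no element
   above the source of p. *)
pose sec b p := xget b [set b' | V b b' /\ src b' = src p].
have secP b p b' : V b b' -> src b' = src p -> sec b p = b'.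
  move=> Vb' b'p; rewrite /sec.
  have [Vs sp] := @xgetI _ b [set b' | V b b' /\ src b' = src p] b' (conj Vb' b'p).
  by apply: (hV b).2 => //; rewrite b'p sp.
have sec0 b : src b = src p0 -> sec b p0 = b by move=> bp; exact: secP.
have sec_near b U : src b = src p0 -> nbhs b U ->
    \forall p \near p0, [/\ U (sec b p), V b (sec b p) & src (sec b p) = src p].
  move=> bp bU; have bUV : nbhs b (U `&` V b) by apply: filterI bU _; exact: (hV b).1.
  have := src_open bp bUV.
  by apply: nearS => p [b' [Ub' Vb'] b'p]; rewrite (secP _ _ _ Vb' b'p).
have sec_cvg b : src b = src p0 -> sec b @ p0 --> b.
  by move=> bp U bU; apply: nearS (sec_near b U bp bU) => p [].
have sec_src b : src b = src p0 -> \forall p \near p0, src (sec b p) = src p.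
  by move=> bp; apply: nearS (sec_near b _ bp (hV b).1) => p [].
have /finite_seqP[S0 S0E] := src_fiber_finite p0 cD.
pose S := undup S0.
have SE b : b \in S = (D b /\ src b = src p0) :> Prop.
  by rewrite mem_undup -[RHS]/([set b | D b /\ src b = src p0] b) S0E.
have SP b : b \in S -> D b /\ src b = src p0 by rewrite SE.
have formula : \forall p \near p0, convol f h p =
    \sum_(b <- S) (f (gs_mul p (gs_inv (sec b p))) * h (sec b p)).
  have n1 : \forall p \near p0, forall b, b \in S -> src (sec b p) = src p.
    by apply: (near_all FN) => b /SP[_]; exact: sec_src.
  (* Sections through distinct points stay distinct near p0, so no term is counted twice. *)
  have n2 : \forall p \near p0, forall bb, bb \in allpairs pair S S ->
      bb.1 <> bb.2 -> sec bb.1 p <> sec bb.2 p.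
    apply: (near_all FN) => _ /allpairsP[[b b'] /= [/SP[_ bp] /SP[_ b'p] ->]] /=.
    have [->|nbb] := pselect (b = b'); first exact: nearW.
    have [U [U' [bU bU' UU]]] := gs_separated nbb.
    have h1 : \forall p \near p0, U (sec b p) := sec_cvg b bp U bU.
    have h2 : \forall p \near p0, U' (sec b' p) := sec_cvg b' b'p U' bU'.
    apply: nearS (nearI _ _ h1 h2) => p [Up U'p] _ E.
    have : (U `&` U') (sec b p) by split => //; rewrite E.
    by rewrite UU.
  (* Compactness of D: near p0 no element of D above p escapes the listed sections. *)
  have n3 : \forall p \near p0, D `<=`
      [set b' | src b' = src p -> exists2 b, b \in S & b' = sec b p].
    have /compact_near_coveringP/(_ _ (nbhs p0) (fun p b' => D b' -> src b' = src p ->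
      exists2 b, b \in S & b' = sec b p)) := cD.
    move=> /(_ _) h3; apply: nearS (h3 _) => [p hp b' Db' b'p|b Db]; first exact: hp.
    have [bp|bp] := pselect (src b = src p0).
      exists (V b, setT); first by split; [exact: (hV b).1|exact: filterT].
      move=> [b' p] /= [Vb' _] _ b'p; exists b; first by rewrite SE.
      by rewrite (secP _ _ _ Vb' b'p).
    have [A [B [bA pB AB]]] := src_separated bp.
    exists (A, B) => //; move=> [b' p] /= [Ab' Bp] _ /(AB _ _ Ab' Bp) //.
  apply: nearS (nearI _ _ n1 (nearI _ _ n2 n3)) => p [s1 [s2 s3]].
  rewrite convolE.
  have inj : set_inj [set` S] (sec ^~ p).
    move=> b b' bS b'S; apply: contraPP => nbb.
    apply: (s2 (b, b')) => //; apply/allpairsP; exists (b, b'); split => //.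
      by move: bS; rewrite inE.
    by move: b'S; rewrite inE.
  rewrite -(fsbig_widen ((sec ^~ p) @` [set` S])).
  - by rewrite (fsbig_image _ _ _ inj) -fsbig_seq // undup_uniq.
  - by move=> _ [b bS <-]; exact: s1.
  - move=> b /= [bp nb]; rewrite /preimage /= hD ?mulr0 // => Db; apply: nb.
    by have [b' b'S ->] := s3 b Db bp; exists b'.
have cvg_sum : \sum_(b <- S) (f (gs_mul p (gs_inv (sec b p))) * h (sec b p)) @[p --> p0] -->
    \sum_(b <- S) (f (gs_mul p0 (gs_inv b)) * h b).
  rewrite big_seq; under eq_fun do rewrite big_seq.
  have addc : continuous (fun x : C * C => x.1 + x.2).
    by move=> [x y]; apply: cvgD; [exact: cvg_fst|exact: cvg_snd].
  apply: (cvg_big addc (Ff := fun b p => f (gs_mul p (gs_inv (sec b p))) * h (sec b p))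
    (Fa := fun b => f (gs_mul p0 (gs_inv b)) * h b)) => b /SP[_ bp].
  apply: cvgM; last by apply: cvg_comp (sec_cvg b bp) (ch b).
  have invc : (fun p => gs_inv (sec b p)) @ (p0 : G) --> gs_inv b.
    exact: (cvg_comp _ _ (sec_cvg b bp) (@gs_inv_continuous R W P b)).
  have idc : (fun p : G => p) @ (p0 : G) --> (p0 : G) by exact: cvg_id.
  have srcE : \forall p \near (p0 : G), src p = rng (gs_inv (sec b p)).
    by apply: nearS (sec_src b bp) => p /= ->.
  have mulc := gs_mul_cvg FN (esym bp : src p0 = rng (gs_inv b)) srcE idc invc.
  exact: (cvg_comp _ _ mulc (cf (gs_mul p0 (gs_inv b)))).
have E0 : convol f h p0 = \sum_(b <- S) (f (gs_mul p0 (gs_inv b)) * h b).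
  rewrite (nbhs_singleton formula) big_seq [RHS]big_seq.
  by apply: eq_bigr => b /SP[_ bp]; rewrite sec0.
rewrite /continuous_at E0; apply: cvg_trans cvg_sum.
by apply: near_eq_cvg; apply: nearS formula => p ->.
Qed.

End CompactSupport.

(** * Closure of C_c under convolution, and its exhaustion by the levels *)

Section ConvolutionAlgebra.
Variables (R : realType) (W : wielerData R) (P : invariantSet W).
Local Notation G := (GsT P).
Local Notation C := (Cx R).
Local Notation rng p := (gs_val p).1.
Local Notation src p := (gs_val p).2.
Local Notation gphi := (@gs_phi R W P).
Local Notation gphi_inv := (@gs_phi_inv R W P).
Implicit Types (p q a b : G) (A : set G) (f h : G -> C).

Lemma composable_closed : closed [set ab : G * G | src ab.1 = rng ab.2].
Proof.
rewrite -[X in closed X]setCK; apply: open_closedC; rewrite openE => -[a b] /= ab.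
have [A [B [aA bB AB]]] := src_rng_separated ab.
by exists (A, B) => //= -[a' b'] /= [Aa' Bb']; exact: AB.
Qed.

(** Continuity of [gs_mul] is used only on composable pairs; these are closed, so they cut a compact
    set out of the product. *)
Lemma compact_mul (D E : set G) : compact D -> compact E ->
  compact [set gs_mul ab.1 ab.2 | ab in (D `*` E) `&` [set ab : G * G | src ab.1 = rng ab.2]].
Proof.
move=> cD cE; apply: continuous_compact; last first.
  by apply: compact_closedI; [exact: compact_setX|exact: composable_closed].
apply/subspace_continuousP => -[a b] [_ /= ab].
set F := within _ _.
have FF : Filter F by exact: within_filter.
have h1 : fst @ F --> a by apply: cvg_within_filter; exact: cvg_fst.
have h2 : snd @ F --> b by apply: cvg_within_filter; exact: cvg_snd.
apply: (gs_mul_cvg FF ab _ h1 h2).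
by apply: (@filterS _ F FF _ _ _ (withinT _ _)) => -[a' b'] [].
Qed.

Lemma Cc_convol A f h : open A -> (forall a b p, A a -> A b -> gs_is_mul a b p -> A p) ->
  Cc A f -> Cc A h -> Cc A (convol f h).
Proof.
move=> oA Amul /(CcP _ oA)[cf [D [cD DA] fD]] /(CcP _ oA)[ch [E [cE EA] hE]].
apply/(CcP _ oA); split; first exact: convol_continuous cf ch cE hE.
exists [set gs_mul ab.1 ab.2 | ab in (D `*` E) `&` [set ab : G * G | src ab.1 = rng ab.2]].
  split; first exact: compact_mul.
  by move=> _ [[a b] [[/= /DA Aa /EA Ab] ab] <-]; apply: (Amul a b) => //; apply/gs_mulP.
move=> p nDE; rewrite /convol; apply: fsbig1 => -[a b] /= abp.
have [Da|/fD->] := pselect (D a); last by rewrite mul0r.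
have [Eb|/hE->] := pselect (E b); last by rewrite mulr0.
have [ab pE] := (gs_mulP a b p).1 abp.
by case: nDE; exists (a, b).
Qed.

Lemma convol_comp (th th' : G -> G) f h : cancel th th' -> cancel th' th ->
  (forall a b p, gs_is_mul (th a) (th b) (th p) <-> gs_is_mul a b p) ->
  convol f h \o th = convol (f \o th) (h \o th).
Proof.
move=> thK thK' thM; apply/funext => p; rewrite /= /convol.
rewrite (reindex_fsbig (fun ab => (th ab.1, th ab.2)) [set ab | gs_is_mul ab.1 ab.2 p]) //.
split.
- by move=> [a b] /= /thM.
- by move=> [a b] [a' b'] _ _ [/(can_inj thK) -> /(can_inj thK) ->].
- move=> [a b] /= abp; exists (th' a, th' b); last by rewrite /= !thK'.
  by apply/thM; rewrite !thK'.
Qed.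

Lemma iter_gs_phiK n : cancel (iter n gphi) (iter n gphi_inv).
Proof. by elim: n => // n IH p; rewrite iterSr /= gs_phiK IH. Qed.

Lemma iter_gs_phi_invK n : cancel (iter n gphi_inv) (iter n gphi).
Proof. by elim: n => // n IH p; rewrite iterSr /= gs_phi_invK IH. Qed.

Lemma iter_continuous (th : G -> G) n : continuous th -> continuous (iter n th).
Proof.
move=> cth; elim: n => [|n IH] p; first exact: cvg_id.
exact: (@continuous_comp _ _ _ (iter n th) th p (IH p) (cth _)).
Qed.

Lemma iter_gs_phi_mul n a b p :
  gs_is_mul (iter n gphi a) (iter n gphi b) (iter n gphi p) <-> gs_is_mul a b p.
Proof.
split; last by move=> abp; elim: n => //= n; exact: gs_is_mul_phi.
by elim: n => //= n IH /gs_is_mul_phi_inv; rewrite !gs_phiK.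
Qed.

Lemma iter_gs_phi_inv_mul n a b p :
  gs_is_mul (iter n gphi_inv a) (iter n gphi_inv b) (iter n gphi_inv p) <->
  gs_is_mul a b p.
Proof. by rewrite -(iter_gs_phi_mul n) !iter_gs_phi_invK. Qed.

Lemma iter_gs_phi_inverse n p : gs_inv (iter n gphi p) = iter n gphi (gs_inv p).
Proof. by elim: n => //= n <-; apply: gs_eq. Qed.

Lemma iter_gs_phi_inv_inverse n p :
  gs_inv (iter n gphi_inv p) = iter n gphi_inv (gs_inv p).
Proof. by elim: n => //= n <-; apply: gs_eq. Qed.

Local Notation S k := (germ_at k : set G).

Lemma germ_at_mul k a b p : S k a -> S k b -> gs_is_mul a b p -> S k p.
Proof.
move=> ka kb [ab ap bp]; rewrite /germ_at -ap -bp; apply: same_germ_trans ka _.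
by rewrite ab.
Qed.

Lemma Cc_germ_comp_phi n k f : Cc (S k) f -> Cc (S (k + n)) (f \o iter n gphi).
Proof.
have -> : S (k + n) = iter n gphi @^-1` S k.
  by apply/seteqP; split => p /=; rewrite germ_at_iter_phi.
apply: (@Cc_comp _ _ _ _ (iter n gphi_inv)); first exact: open_germ_at.
- exact: iter_continuous (@gs_phi_continuous R W P).
- exact: iter_continuous (@gs_phi_inv_continuous R W P).
- exact: iter_gs_phiK.
- exact: iter_gs_phi_invK.
Qed.

Lemma Cc_germ_comp_phi_inv n k f : Cc (S (k + n)) f -> Cc (S k) (f \o iter n gphi_inv).
Proof.
have -> : S k = iter n gphi_inv @^-1` S (k + n).
  by apply/seteqP; split => p /=; rewrite -germ_at_iter_phi iter_gs_phi_invK.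
apply: (@Cc_comp _ _ _ _ (iter n gphi)); first exact: open_germ_at.
- exact: iter_continuous (@gs_phi_inv_continuous R W P).
- exact: iter_continuous (@gs_phi_continuous R W P).
- exact: iter_gs_phi_invK.
- exact: iter_gs_phiK.
Qed.

Lemma Cc_germ_leq m n f : (m <= n)%N -> Cc (S m) f -> Cc (S n) f.
Proof.
move=> mn; apply: Cc_sub => [||p]; [exact: open_germ_at|exact: open_germ_at|].
exact: germ_at_leq.
Qed.

Lemma Cc_germT n f : Cc (S n) f -> Cc [set: G] f.
Proof. by apply: Cc_sub => //; [exact: open_germ_at|exact: openT]. Qed.

Lemma Cc_germ_exists f : Cc [set: G] f -> exists n, Cc (S n) f.
Proof.
move=> /(CcP _ openT)[cf [D [cD _] fD]].
have /compact_near_coveringP/(_ _ \oo (fun n p => S n p)) := cD.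
case=> [p _|n _ hn].
  have [m mp] := germ_at_exists p.
  exists (S m, [set n | (m <= n)%N]) => /=.
    split; last by exists m.
    by apply: open_nbhs_nbhs; split => //; exact: open_germ_at.
  by move=> [q n] /= [mq mn]; exact: germ_at_leq mq.
have oS : open (S n) by exact: open_germ_at.
exists n; apply/(CcP _ oS); split => //; exists D => //; split => // p.
by apply: hn => /=.
Qed.

End ConvolutionAlgebra.

Section StarHom.
Variable R : realType.
Implicit Types A B D : cstarAlg R.

Lemma star_hom_comp A B D (f : B -> D) (h : A -> B) :
  is_star_hom f -> is_star_hom h -> is_star_hom (f \o h).
Proof.
move=> [f1 f2 f3] [h1 h2 h3]; split => *; rewrite /= ?h1 ?h2 ?h3 ?f1 ?f2 ?f3 //.
Qed.

Lemma star_hom_sub A B (f : A -> B) x y : is_star_hom f -> f (x - y) = f x - f y.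
Proof. by move=> [f1 _ _]; rewrite addrC -scaleN1r f1 scaleN1r addrC. Qed.

Lemma dense_cs_norm A (S : set A) (x : A) (e : R) : dense S -> 0 < e ->
  exists2 y, S y & cs_norm (x - y) < e.
Proof.
move=> dS e0; have e0' : 0 < (e%:C%C : Cx R) by rewrite ltcR.
have [|y [xy Sy]] := dS (ball x (e%:C%C : Cx R))° _ (@open_interior _ _).
  by exists x; rewrite /interior; exact: nbhsx_ballx.
exists y => //; move/nbhs_singleton: xy.
by rewrite -ball_normE /ball_ /= -cs_normE ltcR.
Qed.

Lemma star_hom_eq_dense A B (S : set A) (f h : A -> B) : dense S ->
  is_star_hom f -> is_star_hom h -> (forall x, S x -> f x = h x) -> f =1 h.
Proof.
move=> dS sf sh fh x; apply/eqP; rewrite -subr_eq0; apply/eqP/cs_norm_small => e e0.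
(* Two homomorphisms, each bounded by 3. *)
have e6 : 0 < e / 6 by rewrite divr_gt0.
have [y Sy xy] := dense_cs_norm x dS e6.
have -> : f x - h x = f (x - y) - h (x - y).
  by rewrite (star_hom_sub x y sf) (star_hom_sub x y sh) (fh y Sy) opprB addrA subrK.
have e2 : 3 * cs_norm (x - y) <= e / 2 by clear -xy; lra.
rewrite (le_trans (cs_normB _ _)) // [e]splitr lerD //.
  exact: le_trans (star_hom_bounded sf _) e2.
exact: le_trans (star_hom_bounded sh _) e2.
Qed.

End StarHom.

(** * Extension of *-homomorphisms from C_c to the completion *)

Section Extension.
Variables (R : realType) (W : wielerData R) (P : invariantSet W).
Local Notation G := (GsT P).
Local Notation C := (Cx R).
Variables (A : set G) (B D : cstarAlg R) (iota : (G -> C) -> B) (rho : (G -> C) -> D).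
Hypotheses (oA : open A) (Amul : forall a b p : G, A a -> A b -> gs_is_mul a b p -> A p).
Hypothesis (Ainv : forall p : G, A p -> A (gs_inv p)).
Hypotheses (Biota : is_groupoid_cstar A iota) (Drho : is_Cc_star_hom A rho).

(** [rho] is one of the homomorphisms over which the full norm is a supremum. *)
Lemma Cc_star_hom_dist f h : Cc A f -> Cc A h ->
  cs_norm (rho f - rho h) <= cs_norm (iota f - iota h).
Proof.
move=> Af Ah; have [[il _ _] _ inorm] := Biota; have [rl _ _] := Drho.
pose k := fun p => (-1 : C) * h p + f p.
have Ak : Cc A k by exact: Cc_lin.
have -> : rho f - rho h = rho k by rewrite rl // scaleN1r addrC.
have -> : iota f - iota h = iota k by rewrite il // scaleN1r addrC.
rewrite -lee_fin inorm //; apply: ereal_sup_ubound.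
by exists D, rho.
Qed.

(** The closure of the set of pairs ([iota f], [rho f]). As a relation it is visibly stable under
    the operations; uniqueness of l then turns this into the homomorphism laws. *)
Definition extends_to (b : B) (l : D) := forall e : R, 0 < e ->
  exists f, [/\ Cc A f, cs_norm (b - iota f) < e & cs_norm (l - rho f) < e].

Lemma extends_to_unique b l l' : extends_to b l -> extends_to b l' -> l = l'.
Proof.
move=> bl bl'; apply/eqP; rewrite -subr_eq0; apply/eqP/cs_norm_small => e e0.
have e4 : 0 < e / 4 by rewrite divr_gt0.
have [f [Af bf lf]] := bl _ e4; have [h [Ah bh lh]] := bl' _ e4.
have := Cc_star_hom_dist Af Ah.
have := cs_dist_triangle b (iota f) (iota h); rewrite [cs_norm (iota f - b)]cs_distC.
have := cs_dist_triangle (rho f) l l'; have := cs_dist_triangle (rho h) (rho f) l'.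
rewrite [cs_norm (rho h - l')]cs_distC; lra.
Qed.

Lemma extends_to_exists b : exists l, extends_to b l.
Proof.
have [_ dB _] := Biota.
have pos n : 0 < (n.+1%:R : R)^-1 by rewrite invr_gt0.
have /choice[u hu] (n : nat) : exists f, Cc A f /\ cs_norm (b - iota f) < n.+1%:R^-1.
  by have [_ [f Af <-] bf] := dense_cs_norm b dB (pos n); exists f.
have small (e : R) : 0 < e -> exists N, forall n, (N <= n)%N -> cs_norm (b - iota (u n)) < e.
  move=> e0; exists (Num.bound e^-1) => n Nn; apply: lt_trans (hu n).2 _.
  rewrite invf_plt ?posrE //; have := archi_boundP (ltW (_ : 0 < e^-1)).
  rewrite invr_gt0 => /(_ e0) /lt_le_trans; apply.
  by rewrite ler_nat (leq_trans Nn).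
have [|l hl] := @cs_complete R D (fun n => rho (u n)).
  move=> e e0; have [N hN] := small (e / 2) (divr_gt0 e0 (ltr0n _ 2)).
  exists N => m n /hN bm /hN bn.
  apply: le_lt_trans (Cc_star_hom_dist (hu m).1 (hu n).1) _.
  have := cs_dist_triangle b (iota (u m)) (iota (u n)).
  by rewrite [cs_norm (iota (u m) - b)]cs_distC; lra.
exists l => e e0; have [N hN] := small _ e0; have [M hM] := hl _ e0.
exists (u (maxn N M)); split; first exact: (hu _).1.
  by apply: hN; exact: leq_maxl.
by rewrite cs_distC; apply: hM; exact: leq_maxr.
Qed.

Lemma extends_to_iota f : Cc A f -> extends_to (iota f) (rho f).
Proof. by move=> Af e e0; exists f; rewrite !subrr !cs_norm0. Qed.

Lemma extends_to_lin (c : C) b b' l l' : extends_to b l -> extends_to b' l' ->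
  extends_to (c *: b + b') (c *: l + l').
Proof.
move=> bl bl' e e0; have [[il _ _] _ _] := Biota; have [rl _ _] := Drho.
have c1 : 0 < Cnorm c + 1 by rewrite ltr_wpDl ?Cnorm_ge0.
have d0 : 0 < e / (Cnorm c + 1) by rewrite divr_gt0.
have [f [Af bf lf]] := bl _ d0; have [h [Ah bh lh]] := bl' _ d0.
exists (fun p => c * f p + h p); split; first exact: Cc_lin.
  rewrite il // opprD addrACA -scalerBr; apply: le_lt_trans (cs_normD _ _) _.
  move: bf bh; rewrite cs_normZ !ltr_pdivlMr // => bf bh.
  have := Cnorm_ge0 c; have := cs_norm_ge0 (b - iota f); have := cs_norm_ge0 (b' - iota h); nra.
rewrite rl // opprD addrACA -scalerBr; apply: le_lt_trans (cs_normD _ _) _.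
move: lf lh; rewrite cs_normZ !ltr_pdivlMr // => lf lh.
have := Cnorm_ge0 c; have := cs_norm_ge0 (l - rho f); have := cs_norm_ge0 (l' - rho h); nra.
Qed.

Lemma cs_mul_dist_lt (E : cstarAlg R) (x y z w : E) (d : R) : d <= 1 ->
  cs_norm (x - z) < d -> cs_norm (y - w) < d ->
  cs_norm (cs_mul x y - cs_mul z w) <= d * (cs_norm x + cs_norm y + 1).
Proof.
move=> d1 xz yw.
have -> : cs_mul x y - cs_mul z w = cs_mul x (y - w) + cs_mul (x - z) w.
  by rewrite cs_mulBr cs_mulBl addrA subrK.
have wy : cs_norm w <= cs_norm y + 1.
  have := cs_normB y (y - w); rewrite opprB addrC subrK => /le_trans; apply.
  by rewrite lerD2l (le_trans (ltW yw)).
have d0 : 0 <= d := le_trans (cs_norm_ge0 _) (ltW xz).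
have e1 : cs_norm (cs_mul x (y - w)) <= cs_norm x * d.
  by rewrite (le_trans (cs_norm_mul _ _)) // ler_wpM2l ?cs_norm_ge0 // ltW.
have e2 : cs_norm (cs_mul (x - z) w) <= d * (cs_norm y + 1).
  by rewrite (le_trans (cs_norm_mul _ _)) // ler_pM ?cs_norm_ge0 // ltW.
apply: le_trans (cs_normD _ _) _; apply: le_trans (lerD e1 e2) _.
by rewrite [cs_norm x * d]mulrC -mulrDr addrA.
Qed.

Lemma extends_to_mul b b' l l' : extends_to b l -> extends_to b' l' ->
  extends_to (cs_mul b b') (cs_mul l l').
Proof.
move=> bl bl' e e0; have [[_ im _] _ _] := Biota; have [_ rm _] := Drho.
(* One f and one h serve both algebras, so M exceeds the constants |b| + |b'| + 1 and |l| + |l'| + 1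
   of the two product estimates. *)
pose M := cs_norm b + cs_norm b' + cs_norm l + cs_norm l' + 2.
have b0 := cs_norm_ge0 b; have b'0 := cs_norm_ge0 b'.
have l0 := cs_norm_ge0 l; have l'0 := cs_norm_ge0 l'.
have M0 : 0 < M by rewrite /M; lra.
pose d := Num.min 1 (e / M).
have d0 : 0 < d by rewrite lt_min ltr01 divr_gt0.
have d1 : d <= 1 by rewrite ge_min lexx.
have dM : d * M <= e by rewrite -ler_pdivlMr // ge_min lexx orbT.
have [f [Af bf lf]] := bl _ d0; have [h [Ah bh lh]] := bl' _ d0.
exists (convol f h); split; first exact: Cc_convol.
  rewrite im //; apply: le_lt_trans (cs_mul_dist_lt d1 bf bh) _.
  by apply: lt_le_trans dM; rewrite ltr_pM2l // /M; lra.
rewrite rm //; apply: le_lt_trans (cs_mul_dist_lt d1 lf lh) _.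
by apply: lt_le_trans dM; rewrite ltr_pM2l // /M; lra.
Qed.

Lemma extends_to_star b l : extends_to b l -> extends_to (cs_star b) (cs_star l).
Proof.
move=> bl e e0; have [[_ _ istar] _ _] := Biota; have [_ _ rstar] := Drho.
have [f [Af bf lf]] := bl _ e0; exists (invol f); split; first exact: Cc_invol.
  by rewrite istar // -cs_starB cs_norm_star.
by rewrite rstar // -cs_starB cs_norm_star.
Qed.

Lemma groupoid_cstar_extend :
  exists theta : B -> D, is_star_hom theta /\ forall f, Cc A f -> theta (iota f) = rho f.
Proof.
have /choice[theta hth] := extends_to_exists; exists theta; split; [split|].
- by move=> c x y; apply: extends_to_unique (hth _) _; exact: extends_to_lin.
- by move=> x y; apply: extends_to_unique (hth _) _; exact: extends_to_mul.
- by move=> x; apply: extends_to_unique (hth _) _; exact: extends_to_star.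
- by move=> f Af; apply: extends_to_unique (hth _) _; exact: extends_to_iota.
Qed.

End Extension.

(** * The inductive limit *)

Section InductiveLimit.
Variables (R : realType) (W : wielerData R) (P : invariantSet W).
Local Notation G := (GsT P).
Local Notation C := (Cx R).
Local Notation S k := (germ_at k : set G).
Local Notation gphi := (@gs_phi R W P).
Local Notation gphi_inv := (@gs_phi_inv R W P).
Implicit Types f h : G -> C.

Lemma germ_open_limit (U : set G) : open U <-> inductive_limit_open (fun k => S k) U.
Proof.
split=> [oU k|oU]; first by apply/open_subspaceP; exists U.
rewrite openE => p Up; have [m mp] := germ_at_exists p.
have /open_subspaceP[V oV VU] := oU m.
have : nbhs p (V `&` S m).
  apply: open_nbhs_nbhs; split; first by apply: openI => //; exact: open_germ_at.
  by rewrite VU.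
by apply: filterS; rewrite VU => q [].
Qed.

Variables (A B0 : cstarAlg R) (iota : (G -> C) -> A) (iota0 : (G -> C) -> B0).
Variable psi : B0 -> B0.
Hypotheses (HA : is_groupoid_cstar [set: G] iota) (HB0 : is_groupoid_cstar (S 0) iota0).
Hypothesis Hpsi : is_star_hom psi.
Hypothesis psiE : forall f, Cc (S 0) f -> psi (iota0 f) = iota0 (f \o gphi_inv).

Lemma comp_iter_phi_star_hom n :
  is_Cc_star_hom (S 0) (fun f => iota (f \o iter n gphi)).
Proof.
have [[il im istar] _ _] := HA.
have CT f : Cc (S 0) f -> Cc [set: G] (f \o iter n gphi).
  by move=> Cf; apply: Cc_germT (Cc_germ_comp_phi n Cf).
split.
- by move=> a f h /CT Cf /CT Ch; rewrite -il.
- move=> f h /CT Cf /CT Ch; rewrite -im //; congr iota.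
  by apply: convol_comp; [exact: iter_gs_phiK|exact: iter_gs_phi_invK|exact: iter_gs_phi_mul].
- move=> f /CT Cf; rewrite -istar //; congr iota.
  by apply/funext => p; rewrite /invol /= iter_gs_phi_inverse.
Qed.

Lemma germ0_extend (D : cstarAlg R) (rho : (G -> C) -> D) : is_Cc_star_hom (S 0) rho ->
  exists theta : B0 -> D, is_star_hom theta /\ forall f, Cc (S 0) f -> theta (iota0 f) = rho f.
Proof.
apply: groupoid_cstar_extend HB0; first exact: open_germ_at.
- by move=> a b p; exact: germ_at_mul.
- by move=> p; exact: same_germ_sym.
Qed.

(** For F in C_c(G_k), the function F o phi^(-k) lives on G_0. Passing from k to k + 1 applies [psi]
    to its class, which the cocone relation absorbs, so the value of [nu k] there is eventually
    constant in k. *)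
Lemma eventually_star_hom (D : cstarAlg R) (nu : nat -> B0 -> D) :
  is_stationary_cocone psi nu -> exists rho : (G -> C) -> D, is_Cc_star_hom [set: G] rho /\
    forall n f, Cc (S 0) f -> rho (f \o iter n gphi) = nu n (iota0 f).
Proof.
move=> [nuH nuS]; have [[il im istar] _ _] := HB0.
(* [rho F] is the eventual value of [v k F], for every function F: it is thus
   multiplicative without knowing which G_k carries a convolution product. *)
pose v k F := nu k (iota0 (F \o iter k gphi_inv)).
pose ev F := [set w : D | exists N, forall k, (N <= k)%N -> v k F = w].
pose rho F := xget 0 (ev F).
have rhoE F w : ev F w -> rho F = w.
  move=> Fw; have [N hN] := Fw; have [M hM] := xgetI 0 Fw.
  exact: etrans (esym (hM _ (leq_maxr N M))) (hN _ (leq_maxl N M)).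
have vS k F : Cc (S k) F -> v k.+1 F = v k F.
  move=> CF; rewrite /v -(nuS k) psiE.
    by congr (nu _ (iota0 _)); apply/funext => p; rewrite /= -iterSr.
  exact: (@Cc_germ_comp_phi_inv _ _ _ k 0).
have vE m k F : Cc (S m) F -> (m <= k)%N -> v k F = v m F.
  move=> CF mk; rewrite -(subnK mk); elim: (k - m)%N => // i IH.
  by rewrite addSn vS //; apply: Cc_germ_leq CF; exact: leq_addl.
have evE m F : Cc (S m) F -> ev F (v m F) by move=> CF; exists m => k; exact: vE.
have common f h : Cc [set: G] f -> Cc [set: G] h -> exists m, Cc (S m) f /\ Cc (S m) h.
  move=> /Cc_germ_exists[m Cf] /Cc_germ_exists[n Ch]; exists (maxn m n); split.
    by apply: Cc_germ_leq Cf; exact: leq_maxl.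
  by apply: Cc_germ_leq Ch; exact: leq_maxr.
have pull k m f : (m <= k)%N -> Cc (S m) f -> Cc (S 0) (f \o iter k gphi_inv).
  by move=> mk Cf; apply: (@Cc_germ_comp_phi_inv _ _ _ k 0); exact: Cc_germ_leq Cf.
exists rho; split; first split.
- move=> a f h Cf Ch; have [m [Sf Sh]] := common _ _ Cf Ch.
  rewrite (rhoE _ _ (evE _ _ Sf)) (rhoE _ _ (evE _ _ Sh)); apply: rhoE.
  exists m => k mk; rewrite -(vE _ _ _ Sf mk) -(vE _ _ _ Sh mk) /v.
  have [nl _ _] := nuH k; rewrite -nl -il //; exact: pull mk _.
- move=> f h Cf Ch; have [m [Sf Sh]] := common _ _ Cf Ch.
  rewrite (rhoE _ _ (evE _ _ Sf)) (rhoE _ _ (evE _ _ Sh)); apply: rhoE.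
  exists m => k mk; rewrite -(vE _ _ _ Sf mk) -(vE _ _ _ Sh mk) /v.
  have [_ nm _] := nuH k; rewrite -nm -im; [|exact: pull mk _|exact: pull mk _].
  congr (nu _ (iota0 _)); apply: convol_comp;
    [exact: iter_gs_phi_invK|exact: iter_gs_phiK|exact: iter_gs_phi_inv_mul].
- move=> f Cf; have [m [Sf _]] := common _ _ Cf Cf.
  rewrite (rhoE _ _ (evE _ _ Sf)); apply: rhoE.
  exists m => k mk; rewrite -(vE _ _ _ Sf mk) /v.
  have [_ _ ns] := nuH k; rewrite -ns -istar; last exact: pull mk _.
  congr (nu _ (iota0 _)).
  by apply/funext => p; rewrite /invol /= iter_gs_phi_inv_inverse.
- move=> n f Cf; have Sf := Cc_germ_comp_phi n Cf.
  rewrite (rhoE _ _ (evE _ _ Sf)) /v; congr (nu _ (iota0 _)).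
  by apply/funext => p; rewrite /= iter_gs_phi_invK.
Qed.

Lemma stationary_limit : exists mu : nat -> B0 -> A, is_stationary_limit psi mu.
Proof.
have [_ dB0 _] := HB0; have [_ dA _] := HA.
have /choice[mu hmu] (n : nat) := germ0_extend (comp_iter_phi_star_hom n).
exists mu; split; first split.
- by move=> n; have [] := hmu n.
- move=> n; apply: (star_hom_eq_dense dB0).
  + by apply: star_hom_comp Hpsi; have [] := hmu n.+1.
  + by have [] := hmu n.
  + move=> _ [f Cf <-]; rewrite /= psiE // (hmu n).2 // (hmu n.+1).2.
      by congr iota; apply/funext => p; rewrite /= gs_phiK.
    by apply: (@Cc_germ_comp_phi_inv _ _ _ 1 0); exact: Cc_germ_leq Cf.
- move=> D nu hnu; have [rho [rhoH rhoE]] := eventually_star_hom hnu.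
  have [theta [thH thE]] : exists theta : A -> D, is_star_hom theta /\
      forall f, Cc [set: G] f -> theta (iota f) = rho f.
    by apply: groupoid_cstar_extend HA rhoH => //; exact: openT.
  exists theta; split; first split => // n b.
    apply: (star_hom_eq_dense dB0 (f := theta \o mu n)).
    + by apply: star_hom_comp thH _; have [] := hmu n.
    + by have [] := hnu.
    + move=> _ [f Cf <-]; rewrite /= (hmu n).2 // thE ?rhoE //.
      exact: Cc_germT (Cc_germ_comp_phi n Cf).
  (* Every [iota f] is in the image of some [mu n], so the values on a dense set are prescribed. *)
  move=> theta' [th'H th'E]; apply/funext; apply: (star_hom_eq_dense dA) => //.
  move=> _ [f Cf <-]; have [n Sf] := Cc_germ_exists Cf.
  have Sf0 : Cc (S 0) (f \o iter n gphi_inv) by exact: (@Cc_germ_comp_phi_inv _ _ _ n 0).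
  have fE : f = (f \o iter n gphi_inv) \o iter n gphi.
    by apply/funext => p; rewrite /= iter_gs_phiK.
  have iE : iota f = mu n (iota0 (f \o iter n gphi_inv)) by rewrite (hmu n).2 // -fE.
  by rewrite thE // {1}fE rhoE // iE th'E.
Qed.

End InductiveLimit.

Theorem theorem3p17 (R : realType) (W : wielerData R) (P : invariantSet W)
    (K0 : nat) (epsY : R)
    (hmix : mixing W)
    (hK0 : (wK W <= K0)%N)
    (hK0_close : forall x y : solenoid W,
       (forall i, (i <= K0)%N -> sol_coord x i = sol_coord y i) ->
       dX x y < wbeta W / 4)
    (hepsY : 0 < epsY < wbeta W / 4)
    (hepsY_phi : forall x : solenoid W,
       iter K0 (@phi R W) @` Xu x epsY `<=`
       Xu (iter K0 (@phi R W) x) (wbeta W / 4)) :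
  (\bigcup_k Gk P epsY k = Gs P /\
   forall U : set (GsT P),
     open U <-> inductive_limit_open (GkT P epsY) U) /\
  (forall (A B0 B1 : cstarAlg R)
     (iota : (GsT P -> Cx R) -> A)
     (iota0 : (GsT P -> Cx R) -> B0)
     (iota1 : (GsT P -> Cx R) -> B1)
     (j : B0 -> B1) (alpha : B1 -> B0),
     is_groupoid_cstar [set: GsT P] iota ->
     is_groupoid_cstar (GkT P epsY 0) iota0 ->
     is_groupoid_cstar (GkT P epsY 1) iota1 ->
     is_cstar_inclusion (GkT P epsY 0) iota0 iota1 j ->
     is_cstar_phi_iso (GkT P epsY 1) iota1 iota0 alpha ->
     exists (L : cstarAlg R) (mu : nat -> B0 -> L),
       is_stationary_limit (alpha \o j) mu /\ cstar_isomorphic A L).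
Proof.
split; first split; first exact: bigcup_Gk.
  have -> : GkT P epsY = fun k => germ_at k by apply/funext => k; exact: GkTE.
  exact: germ_open_limit.
move=> A B0 B1 iota iota0 iota1 j alpha; rewrite !GkTE // => HA HB0 _ [jH jE] [[alH _] alE].
have [||mu hmu] := stationary_limit HA HB0 (psi := alpha \o j).
- exact: star_hom_comp.
- move=> f Cf; rewrite /= jE // alE //; exact: Cc_germ_leq Cf.
exists A, mu; split => //; exists id; split; first by split.
by exists id.
Qed.
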